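(* Let $n\ge1$ and let $\gimel^-$ be the canonical trace form on the spin Hecke algebra $\mathcal{H}^-_{n,\mathbb{K}}$ defined in the context. (1) $\gimel^-(R_{\underline{w_C}})=0$ for any minimal length representative $w_C$ in a non-identity conjugacy class $C$ of $S_n$, with any reduced expression $\underline{w_C}$ of $w_C$. (2) $\gimel^-$ is characterized by the property $\gimel^-(R_{\underline{w_\nu}})=\delta_{\nu,(1^n)}$ for all $\nu\in\mathcal{OP}_n$; that is, $\gimel^-$ is the unique trace function on $\mathcal{H}^-_{n,\mathbb{K}}$ with this property.
   Context: Hecke-Clifford algebra. Let $v$ be an indeterminate. $\mathcal{H}_n^c$ is the associative superalgebra over $\mathbb{C}(v^{1/2})$ with even generators $T_1,\ldots,T_{n-1}$ and odd generators $c_1,\ldots,c_n$ and relations: $(T_i-v)(T_i+1)=0$; $T_iT_j=T_jT_i$ for $|i-j|>1$; $T_iT_{i+1}T_i=T_{i+1}T_iT_{i+1}$; $c_i^2=1$, $c_ic_j=-c_jc_i$ for $i\ne j$; $T_ic_j=c_jT_i$ for $j\neq i,i+1$; $T_ic_i=c_{i+1}T_i$. Let $[k]_v=\frac{v^k-v^{-k}}{v-v^{-1}}$, $\mathbb{K}=\mathbb{C}(v^{1/2})(\sqrt{[1]_v},\ldots,\sqrt{[n]_v})$; a subscript $\mathbb{K}$ denotes base change to $\mathbb{K}$. $\mathcal{C}_n$ is the Clifford superalgebra on $c_1,\ldots,c_n$. Spin Hecke algebra. $\mathcal{H}_n^-$ is the $\mathbb{C}(v^{1/2})$-superalgebra generated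 by odd elements $R_1,\ldots,R_{n-1}$ subject to $R_i^2=-(v^2+1)$; $R_iR_j=-R_jR_i$ for $|i-j|>1$; $R_iR_{i+1}R_i-R_{i+1}R_iR_{i+1}=(v-1)^2(R_{i+1}-R_i)$. For a reduced expression $\underline\sigma=s_{i_1}\cdots s_{i_r}$ of $\sigma\in S_n$ ($s_i=(i,i+1)$), put $R_{\underline\sigma}=R_{i_1}\cdots R_{i_r}$. For a composition $\gamma=(\gamma_1,\ldots,\gamma_\ell)$ of $n$ (positive parts), $\underline{w_\gamma}=(s_1\cdots s_{\gamma_1-1})(s_{\gamma_1+1}\cdots s_{\gamma_1+\gamma_2-1})\cdots(s_{\gamma_1+\cdots+\gamma_{\ell-1}+1}\cdots s_{n-1})$ is a reduced expression of an element $w_\gamma$; $T_{w_\gamma}$ and $R_{\underline{w_\gamma}}$ are the products of the $T_i$, resp. $R_i$, in this order (in particular $R_{\underline{w_{(1^n)}}}=1$). $\mathcal{OP}_n$ is the set of partitions of $n$ with all parts odd; $\ell(\nu)$ is the number of nonzero parts. Trace forms. A trace function on an $R$-superalgebra $\mathcal{H}$ is an $R$-linear $\phi:\mathcal{H}\to R$ with $\phi(hh')=\phi(h'h)$ and $\phi(h)=0$ for odd $h$. Let $\gimel:\mathcal{H}_{n,\mathbb{K}}^c\to\mathbb{K}$ be the unique trace function with $\gimel(T_{w_\nu})=\left(\frac{v-1}{2}\right)^{n-\ell(\nu)}$ for all $\nu\in\mathcal{OP}_n$. There is a known superalgebra isomorphism $\Psi:\mathcal{H}_n^-\otimes\mathcal{C}_n\to\mathcal{H}_n^c$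 (super tensor product) with $\Psi(R_i)=(c_i-c_{i+1})T_i+(v-1)c_{i+1}$ and $\Psi(c_i)=c_i$, whose inverse $\Phi$ satisfies $\Phi(T_i)=-\frac12R_i(c_i-c_{i+1})+\frac{v-1}{2}(1-c_ic_{i+1})$. The trace form $\gimel^-$ on $\mathcal{H}^-_{n,\mathbb{K}}$ is $\gimel^-(h)=\gimel(\Psi(h\otimes1))$. *)

(* Defs.v *)
From HB Require Import structures.
From mathcomp Require Import all_boot all_order all_fingroup all_algebra all_field.
From mathcomp Require Import boolp reals complex generic_quotient.

Set Implicit Arguments.
Unset Strict Implicit.
Unset Printing Implicit Defensive.

Import GRing.Theory.
Local Open Scope ring_scope.
Local Open Scope quotient_scope.

Inductive pterm (K X : Type) : Type :=
| Gen of X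
| Cst of K
| Add of pterm K X & pterm K X
| Mul of pterm K X & pterm K X.
Arguments Gen {K X} _.
Arguments Cst {K X} _%_R.

HB.instance Definition _ (K X : Type) := gen_eqMixin (pterm K X).
HB.instance Definition _ (K X : Type) := gen_choiceMixin (pterm K X).

Declare Scope pterm_scope.
Delimit Scope pterm_scope with PT.
Bind Scope pterm_scope with pterm.
Notation "x + y" := (Add x y) : pterm_scope.
Notation "x * y" := (Mul x y) : pterm_scope.
Notation "- x" := (Mul (Cst (- 1%R)%R) x) : pterm_scope.
Notation "x - y" := (Add x (- y)%PT) : pterm_scope.

(* [pdeg x b] says that the generator [x] may be given parity [b]
   ([false] is even, [true] is odd); it is a relation because in [stensor]
   below every element of a superalgebra, homogeneous or not, is a generator. *)
Record presentation (K : Type) := Presentation {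
  pgen : Type;
  pdeg : pgen -> bool -> Prop;
  prel : pterm K pgen -> pterm K pgen -> Prop
}.

Section Congruence.
Variables (K : comNzRingType) (P : presentation K).

(* The smallest congruence on terms that contains the relations of [P] and
   whose quotient is an associative unital [K]-algebra with structure map
   [Cst]. *)
Inductive congr : pterm K (pgen P) -> pterm K (pgen P) -> Prop :=
| CgRel x y : prel x y -> congr x y
| CgRefl x : congr x x
| CgSym x y : congr x y -> congr y x
| CgTrans x y z : congr x y -> congr y z -> congr x z
| CgAdd x x' y y' : congr x x' -> congr y y' -> congr (x + y) (x' + y')
| CgMul x x' y y' : congr x x' -> congr y y' -> congr (x * y) (x' * y')
| CgAddA x y z : congr (x + (y + z)) (x + y + z)
| CgAddC x y : congr (x + y) (y + x)
| CgAdd0 x : congr (Cst 0 + x) x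
| CgMulA x y z : congr (x * (y * z)) (x * y * z)
| CgMul1l x : congr (Cst 1 * x) x
| CgMul1r x : congr (x * Cst 1) x
| CgMul0 x : congr (Cst 0 * x) (Cst 0)
| CgMulDl x y z : congr ((x + y) * z) (x * z + y * z)
| CgMulDr x y z : congr (x * (y + z)) (x * y + x * z)
| CgCstD a b : congr (Cst (a + b)) (Cst a + Cst b)
| CgCstM a b : congr (Cst (a * b)) (Cst a * Cst b)
| CgCstC a x : congr (Cst a * x) (x * Cst a).

Definition congrb : rel (pterm K (pgen P)) := fun x y => `[< congr x y >].

Fact congrb_equiv : equiv_class_of congrb.
Proof.
split=> [x|x y|y x z].
- by apply/asboolP; exact: CgRefl.
- by apply/asboolP/asboolP => /CgSym.
- by move=> /asboolP xy /asboolP yz; apply/asboolP; exact: CgTrans xy yz.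
Qed.

Canonical congr_equiv := EquivRelPack congrb_equiv.

Definition palg : Type := {eq_quot congrb}.
HB.instance Definition _ := Choice.on palg.
HB.instance Definition _ := EqQuotient.on palg.

Definition pcls (t : pterm K (pgen P)) : palg := \pi_palg t.

Fact pclsP s t : (pcls s = pcls t) <-> congr s t.
Proof.
split=> [/eqquotP/asboolP //|st].
by apply/eqquotP/asboolP.
Qed.

Fact pclsK (x : palg) : pcls (repr x) = x.
Proof. exact: reprK. Qed.

Fact repr_congr t : congr (repr (pcls t)) t.
Proof. by apply/pclsP; rewrite pclsK. Qed.

Definition padd (x y : palg) : palg := pcls (repr x + repr y).
Definition pmul (x y : palg) : palg := pcls (repr x * repr y).
Definition pscale (a : K) (x : palg) : palg := pcls (Cst a * repr x).
Definition popp (x : palg) : palg := pscale (- 1) x.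

Fact paddE s t : padd (pcls s) (pcls t) = pcls (s + t).
Proof. by apply/pclsP/CgAdd; exact: repr_congr. Qed.
Fact pmulE s t : pmul (pcls s) (pcls t) = pcls (s * t).
Proof. by apply/pclsP/CgMul; exact: repr_congr. Qed.
Fact pscaleE a t : pscale a (pcls t) = pcls (Cst a * t).
Proof. by apply/pclsP/CgMul; [exact: CgRefl|exact: repr_congr]. Qed.

Let pclsW (Q : palg -> Prop) : (forall t, Q (pcls t)) -> forall x, Q x.
Proof. by move=> Qt x; rewrite -(pclsK x). Qed.

Fact paddA : associative padd.
Proof.
move=> x y z; rewrite -(pclsK x) -(pclsK y) -(pclsK z) !paddE.
by apply/pclsP; exact: CgAddA.
Qed.
Fact paddC : commutative padd.
Proof.
by move=> x y; rewrite -(pclsK x) -(pclsK y) !paddE; apply/pclsP/CgAddC.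
Qed.
Fact padd0 : left_id (pcls (Cst 0)) padd.
Proof. by elim/pclsW=> x; rewrite paddE; apply/pclsP/CgAdd0. Qed.
Fact paddN : left_inverse (pcls (Cst 0)) popp padd.
Proof.
elim/pclsW=> x; rewrite /popp pscaleE paddE; apply/pclsP.
apply: CgTrans (CgMul0 x).
apply: CgTrans (CgMul _ (CgRefl x)); last first.
  have := CgCstD (- 1) 1; rewrite addNr; exact: CgSym.
apply: CgTrans (CgSym (CgMulDl _ _ _)).
by apply: CgAdd; [exact: CgRefl|exact/CgSym/CgMul1l].
Qed.
HB.instance Definition _ := GRing.isZmodule.Build palg paddA paddC padd0 paddN.

Fact pmulA : associative pmul.
Proof.
move=> x y z; rewrite -(pclsK x) -(pclsK y) -(pclsK z) !pmulE.
by apply/pclsP; exact: CgMulA.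
Qed.
Fact pmul1l : left_id (pcls (Cst 1)) pmul.
Proof. by elim/pclsW=> x; rewrite pmulE; apply/pclsP/CgMul1l. Qed.
Fact pmul1r : right_id (pcls (Cst 1)) pmul.
Proof. by elim/pclsW=> x; rewrite pmulE; apply/pclsP/CgMul1r. Qed.
Fact pmulDl : left_distributive pmul +%R.
Proof.
move=> x y z; rewrite -(pclsK x) -(pclsK y) -(pclsK z).
by rewrite /GRing.add /= !(pmulE, paddE); apply/pclsP/CgMulDl.
Qed.
Fact pmulDr : right_distributive pmul +%R.
Proof.
move=> x y z; rewrite -(pclsK x) -(pclsK y) -(pclsK z).
by rewrite /GRing.add /= !(pmulE, paddE); apply/pclsP/CgMulDr.
Qed.
(* A presented algebra may a priori be trivial, hence a [pzRingType] together
   with an [lmodType K], and not a (nontrivial) [algType K]. *)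
HB.instance Definition _ :=
  GRing.Zmodule_isPzRing.Build palg pmulA pmul1l pmul1r pmulDl pmulDr.

Fact pscaleA a b x : pscale a (pscale b x) = pscale (a * b) x.
Proof.
elim/pclsW: x => x; rewrite !pscaleE; apply/pclsP.
apply: CgTrans (CgMulA _ _ _) _; apply: CgMul (CgRefl _).
exact/CgSym/CgCstM.
Qed.
Fact pscale1 : left_id 1 pscale.
Proof. by elim/pclsW=> x; rewrite pscaleE; apply/pclsP/CgMul1l. Qed.
Fact pscaleDr : right_distributive pscale +%R.
Proof.
move=> a x y; rewrite -(pclsK x) -(pclsK y) /GRing.add /=.
by rewrite !(pscaleE, paddE); apply/pclsP/CgMulDr.
Qed.
Fact pscaleDl (x : palg) : {morph pscale^~ x : a b / a + b}.
Proof.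
move=> a b; elim/pclsW: x => x; rewrite /GRing.add /= !(pscaleE, paddE).
apply/pclsP; apply: CgTrans (CgMulDl _ _ _); apply: CgMul (CgRefl _).
exact: CgCstD.
Qed.
HB.instance Definition _ := GRing.Zmodule_isLmodule.Build K palg
  pscaleA pscale1 pscaleDr pscaleDl.

Definition pelt (x : pgen P) : palg := pcls (Gen x).

(* The homogeneous component of parity [b]: the span of the products of
   generators of total parity [b]. *)
Inductive homog : bool -> palg -> Prop :=
| Homog0 b : homog b 0
| HomogD b x y : homog b x -> homog b y -> homog b (x + y)
| HomogZ b a x : homog b x -> homog b (a *: x)
| Homog1 : homog false 1
| HomogGen b x : pdeg x b -> homog b (pelt x)
| HomogM b c x y : homog b x -> homog c y -> homog (b (+) c) (x * y).

Definition trace_function (phi : palg -> K) : Prop :=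
  [/\ scalar phi,
      forall h h', phi (h * h') = phi (h' * h)
    & forall h, homog true h -> phi h = 0].

End Congruence.

Section SuperTensor.
Variables (K : comNzRingType) (P Q : presentation K).

Local Notation tm := (pterm K (palg P + palg Q)).
Let lft (x : palg P) : tm := Gen (inl x).
Let rgt (y : palg Q) : tm := Gen (inr y).

(* The superalgebra generated by copies of [palg P] and [palg Q] subject to
   their own operations and to (1 # y)(x # 1) = (-1)^(|x||y|) (x # 1)(1 # y). *)
Inductive stensor_rel : tm -> tm -> Prop :=
| SLD x x' : stensor_rel (lft (x + x')) (lft x + lft x')
| SLZ a x : stensor_rel (lft (a *: x)) (Cst a * lft x)
| SLM x x' : stensor_rel (lft (x * x')) (lft x * lft x')
| SL1 : stensor_rel (lft 1) (Cst 1)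
| SRD y y' : stensor_rel (rgt (y + y')) (rgt y + rgt y')
| SRZ a y : stensor_rel (rgt (a *: y)) (Cst a * rgt y)
| SRM y y' : stensor_rel (rgt (y * y')) (rgt y * rgt y')
| SR1 : stensor_rel (rgt 1) (Cst 1)
| SSuper b c x y : homog b x -> homog c y ->
    stensor_rel (rgt y * lft x) (Cst ((-1) ^+ (b && c)) * (lft x * rgt y)).

Definition stensor : presentation K :=
  Presentation
    (fun z b => match z with inl x => homog b x | inr y => homog b y end)
    stensor_rel.

Definition pure_tensor (x : palg P) (y : palg Q) : palg stensor :=
  pelt (P := stensor) (inl x) * pelt (P := stensor) (inr y).

End SuperTensor.

(* Throughout n = m.+1: the n - 1 generators T_i (resp. R_i) are indexed by
   'I_m and the c_j by 'I_m.+1, both counted from 0.  [ix0 i] and [ix1 i] are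
   the positions i and i + 1. *)
Definition ix0 m (i : 'I_m) : 'I_m.+1 := widen_ord (leqnSn m) i.
Definition ix1 m (i : 'I_m) : 'I_m.+1 := lift ord0 i.

Definition far m (i j : 'I_m) : bool := (i.+1 < j)%N || (j.+1 < i)%N.

Section Algebras.
Variables (K : comNzRingType) (v : K) (m : nat).

Local Notation hterm := (pterm K ('I_m + 'I_m.+1)).
Let T i : hterm := Gen (inl i).
Let c j : hterm := Gen (inr j).

Inductive hecke_clifford_rel : hterm -> hterm -> Prop :=
| HCquad i : hecke_clifford_rel ((T i - Cst v) * (T i + Cst 1)) (Cst 0)
| HCfar i j : far i j -> hecke_clifford_rel (T i * T j) (T j * T i)
| HCbraid (i j : 'I_m) : j = i.+1 :> nat ->
    hecke_clifford_rel (T i * T j * T i) (T j * T i * T j)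
| HCsq j : hecke_clifford_rel (c j * c j) (Cst 1)
| HCanti j k : j != k -> hecke_clifford_rel (c j * c k) (- (c k * c j))
| HCcomm i j : j != ix0 i -> j != ix1 i ->
    hecke_clifford_rel (T i * c j) (c j * T i)
| HCmove i : hecke_clifford_rel (T i * c (ix0 i)) (c (ix1 i) * T i).

Definition hecke_clifford : presentation K :=
  Presentation
    (fun z b => match z with inl _ => b = false | inr _ => b = true end)
    hecke_clifford_rel.

Definition hcT (i : 'I_m) : palg hecke_clifford :=
  pelt (P := hecke_clifford) (inl i).
Definition hcC (j : 'I_m.+1) : palg hecke_clifford :=
  pelt (P := hecke_clifford) (inr j).

Local Notation cterm := (pterm K 'I_m.+1).

Inductive clifford_rel : cterm -> cterm -> Prop :=
| Csq j : clifford_rel (Gen j * Gen j) (Cst 1)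
| Canti j k : j != k -> clifford_rel (Gen j * Gen k) (- (Gen k * Gen j)).

Definition clifford : presentation K :=
  Presentation (fun _ b => b = true) clifford_rel.

Definition clC (j : 'I_m.+1) : palg clifford := pelt (P := clifford) j.

Local Notation sterm := (pterm K 'I_m).
Let R i : sterm := Gen i.

Inductive spin_hecke_rel : sterm -> sterm -> Prop :=
| SHquad i : spin_hecke_rel (R i * R i) (Cst (- (v ^+ 2 + 1)))
| SHfar i j : far i j -> spin_hecke_rel (R i * R j) (- (R j * R i))
| SHbraid (i j : 'I_m) : j = i.+1 :> nat ->
    spin_hecke_rel (R i * R j * R i - R j * R i * R j)
                   (Cst ((v - 1) ^+ 2) * (R j - R i)).

Definition spin_hecke : presentation K :=
  Presentation (fun _ b => b = true) spin_hecke_rel.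

Definition shR (i : 'I_m) : palg spin_hecke := pelt (P := spin_hecke) i.

Definition hcT_word (u : seq 'I_m) : palg hecke_clifford := \prod_(i <- u) hcT i.
Definition shR_word (u : seq 'I_m) : palg spin_hecke := \prod_(i <- u) shR i.

Definition Psi_spec
    (Psi : {rmorphism palg (stensor spin_hecke clifford)
                      -> palg hecke_clifford}) : Prop :=
  [/\ scalable Psi, bijective Psi,
      forall b x, homog b x -> homog b (Psi x),
      forall i, Psi (pure_tensor (shR i) 1) =
        (hcC (ix0 i) - hcC (ix1 i)) * hcT i + (v - 1) *: hcC (ix1 i)
    & forall j, Psi (pure_tensor 1 (clC j)) = hcC j].

End Algebras.

(* C(v^{1/2}), the indeterminate of {poly R[i]} being v^{1/2}. *)
Definition Cvhalf (R : realType) : fieldType := {fraction {poly R[i]}}.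

Definition vv (R : realType) : Cvhalf R := tofrac ('X ^+ 2).

Definition qint (R : realType) (k : nat) : Cvhalf R :=
  (vv R ^+ k - vv R ^- k) / (vv R - (vv R)^-1).

(* C(v^{1/2})(sqrt[1], ..., sqrt[n]); this determines K up to isomorphism over
   C(v^{1/2}). *)
Definition is_sqrt_extension (R : realType) (n : nat)
    (K : fieldExtType (Cvhalf R)) : Prop :=
  exists r : 'I_n -> K,
    (forall k : 'I_n, r k ^+ 2 = (qint R k.+1)%:A)
    /\ <<1 & codom r>>%VS = fullv.

Definition stransp m (i : 'I_m) : 'S_m.+1 := tperm (ix0 i) (ix1 i).

(* MathComp composes permutations from left to right; with the opposite
   convention a word represents the inverse permutation, which has the same
   length and lies in the same conjugacy class. *)
Definition sprod m (u : seq 'I_m) : 'S_m.+1 := (\prod_(i <- u) stransp i)%g.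

Definition has_word m (w : 'S_m.+1) (k : nat) : bool :=
  [exists u : k.-tuple 'I_m, sprod u == w].

Fact has_word_ex m (w : 'S_m.+1) : exists k, has_word w k.
Proof.
suff [u <-] : exists u : seq 'I_m, sprod u = w.
  by exists (size u); apply/existsP; exists (in_tuple u).
have mulE u1 u2 : sprod (u1 ++ u2) = (sprod u1 * sprod u2)%g :> 'S_m.+1.
  by rewrite /sprod big_cat.
have adj d : forall x y : 'I_m.+1, (y = x + d.+1 :> nat)%N ->
    exists u : seq 'I_m, sprod u = tperm x y.
  elim: d => [|d IH] x y yE.
    have xm : (x < m)%N by rewrite -ltnS (leq_trans _ (ltn_ord y)) // yE addn1.
    exists [:: Ordinal xm]; rewrite /sprod big_seq1 /stransp.
    by congr tperm; apply: val_inj => //=; rewrite /bump yE addn1.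
  have zm : (x + d.+1 < m)%N.
    by rewrite -ltnS (leq_trans _ (ltn_ord y)) // yE !addnS.
  have [u uE] := IH x (ix0 (Ordinal zm)) erefl.
  exists ([:: Ordinal zm] ++ u ++ [:: Ordinal zm]).
  have sE : sprod [:: Ordinal zm] = tperm (ix0 (Ordinal zm)) y.
    rewrite /sprod big_seq1 /stransp; congr tperm; apply: val_inj.
    by rewrite /= /bump yE !addnS.
  rewrite !mulE uE sE.
  set z := ix0 _.
  have zy : z != y by rewrite -val_eqE /= yE eqn_add2l (ltn_eqF (ltnSn _)).
  have xy : x != y by rewrite -val_eqE /= yE -[X in X == _]addn0 eqn_add2l.
  rewrite -[X in (X * _)%g]tpermV -conjgE tpermJ tpermL.
  have xz : x != z by rewrite -val_eqE /= -[X in X == _]addn0 eqn_add2l.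
  by rewrite tpermD // eq_sym.
have [ts -> _] := prod_tpermP w.
elim: ts => [|[x y] ts [u uE]]; first by exists [::]; rewrite /sprod !big_nil.
rewrite big_cons /= -uE.
have [u' <-] : exists u', sprod u' = tperm x y; last by exists (u' ++ u).
case: (ltngtP x y) => [xy|yx|/val_inj ->].
- by apply: (adj (y - x).-1); rewrite prednK ?subn_gt0 // subnKC // ltnW.
- rewrite tpermC; apply: (adj (x - y).-1).
  by rewrite prednK ?subn_gt0 // subnKC // ltnW.
- by exists [::]; rewrite tperm1 /sprod big_nil.
Qed.

Definition coxeter_length m (w : 'S_m.+1) : nat := ex_minn (has_word_ex w).

Definition reduced_expression m (w : 'S_m.+1) (u : seq 'I_m) : Prop :=
  sprod u = w /\ size u = coxeter_length w.

Definition minimal_length_in m (C : {set 'S_m.+1}) (w : 'S_m.+1) : Prop :=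
  w \in C /\ forall w', w' \in C -> (coxeter_length w <= coxeter_length w')%N.

(* [gamma_word_from a gamma] is the word of a composition gamma whose first
   block starts at position a; the block of length g contributes the indices
   a, ..., a + g - 2. *)
Fixpoint gamma_word_from (a : nat) (gamma : seq nat) : seq nat :=
  if gamma is g :: gamma' then iota a g.-1 ++ gamma_word_from (a + g) gamma'
  else [::].

(* For a composition of m.+1 all the indices are < m and none is dropped. *)
Definition gamma_word m (gamma : seq nat) : seq 'I_m :=
  pmap insub (gamma_word_from 0 gamma).

Definition odd_partition (n : nat) (nu : seq nat) : bool :=
  [&& sorted geq nu, all odd nu & sumn nu == n].

Section Traces.
Variables (K : fieldType) (v : K) (m : nat).

Definition is_gimel (gimel : palg (hecke_clifford v m) -> K) : Prop :=
  trace_function gimel /\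
  forall nu, odd_partition m.+1 nu ->
    gimel (hcT_word v (gamma_word m nu)) = ((v - 1) / 2) ^+ (m.+1 - size nu).

Definition gimel_minus
    (Psi : palg (stensor (spin_hecke v m) (clifford K m))
           -> palg (hecke_clifford v m))
    (gimel : palg (hecke_clifford v m) -> K) (h : palg (spin_hecke v m)) : K :=
  gimel (Psi (pure_tensor h 1)).

Definition delta_on_OP (phi : palg (spin_hecke v m) -> K) : Prop :=
  forall nu, odd_partition m.+1 nu ->
    phi (shR_word v (gamma_word m nu)) = (nu == nseq m.+1 1%N)%:R.

End Traces.

(* Main.v *)
Require Import Defs.
From HB Require Import structures.
From mathcomp Require Import all_boot all_order all_fingroup all_algebra all_field.
From mathcomp Require Import boolp reals complex zify generic_quotient.

(** Let [S] be the super tensor product of the spin Hecke algebra and the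
    Clifford superalgebra, and let [t] be a trace on [S].  Everything follows
    from comparing the values of [t] on products of the [R_i] with its values on
    products of the Hecke generators.  Through [Psi] these are the elements
    [T_i = (- R_i + (v - 1) c_i) (c_i - c_(i+1)) / 2] of [S].

    A trace kills every product in which some Clifford generator occurs exactly
    once.  Hence, for a strictly increasing word [u], the value [t(T_u)] is a
    combination of the [t(R_w)] for [w] a subword of [u] ([expansion]).  If all
    [t(R_w)] with [w] nonempty and shorter than [u] vanish, two terms are left:
    [t(T_u) = kappa(u) t(R_u) + ((v - 1) / 2)^|u| t(1)].  Cut [u] into its
    maximal blocks of consecutive letters.
    - If some block has oddly many letters, then [t(R_u) = 0] for every trace:
      either [R_u] is odd, or it is the product of two anticommuting odd
      elements ([trace_unpaired]).
    - If all blocks have evenly many letters, then [kappa(u)] is nonzero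
      ([leading_neq0]) and [u] is the word of a composition with odd parts
      ([paired_gamma_word]).  The value [t(T_u)] does not change when the parts
      are sorted, because the [T_i] satisfy exact braid relations, so that two
      neighbouring blocks can be exchanged by conjugation
      ([trace_gamma_perm]).  The braid relations of the [R_i] have lower order
      terms, and this is why the proof leaves the spin Hecke algebra.
    By induction on the length, [t(R_u) = 0] for all nonempty increasing [u] as
    soon as this is known for the words of odd partitions, in the course of the
    same induction ([trace_vanishing]).  For the trace form [gimel] it is known
    because the prescribed value at [T_(w_nu)] is exactly the second of the two
    terms above.

    A minimal length element of a conjugacy class has no reduced expression with
    a repeated letter ([minimal_length_uniq]), and the value of a trace on such
    a product is, up to sign, its value on the increasing rearrangement
    ([trace_uniq]).  This gives the first part and the existence in the second.

    For uniqueness, let [chi] be the difference of two traces with the stated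
    values.  It extends to a trace on [S] ([extend_trace]), so it vanishes on
    all [R_u] with [u] increasing, and these span the spin Hecke algebra modulo
    commutators ([trace_eq0]).

    The reductions to increasing words, in the symmetric group and in the spin
    Hecke algebra, are instances of one induction principle on words,
    [word_ind]. *)

Set Implicit Arguments.
Unset Strict Implicit.
Unset Printing Implicit Defensive.

Import GRing.Theory.
Local Open Scope ring_scope.

(** * Words and their reduction to strictly increasing words *)

Section Words.
Variable m : nat.
Implicit Types (u w x y z : seq 'I_m) (i j k : 'I_m).

Definition incr u : bool := sorted ltn (map val u).

(* The bound [j] is a natural number rather than a letter, so that it can reach
   [m] in the inductions below. *)
Definition cnt (j : nat) u := count (fun i => val i == j) u.

Lemma cnt_cat (j : nat) u w : cnt j (u ++ w) = (cnt j u + cnt j w)%N.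
Proof. exact: count_cat. Qed.

Lemma cnt_cons (j : nat) i u : cnt j (i :: u) = ((val i == j) + cnt j u)%N.
Proof. by []. Qed.

Lemma cnt_nil (j : nat) : cnt j [::] = 0%N.
Proof. by []. Qed.

Lemma cnt_eq0 (j : nat) u :
  (cnt j u == 0)%N = all (fun i => val i != j) u.
Proof. by rewrite /cnt -leqn0 leqNgt -has_count -all_predC. Qed.

(* The moves are oriented as reductions: [P] holds for a word if it holds for all
   the words on the right of a relation, including the lower order terms of the
   braid relation. *)
Section WordInduction.
Variable P : seq 'I_m -> Prop.
Hypothesis P_square : forall x i y, P (x ++ y) -> P (x ++ [:: i; i] ++ y).
Hypothesis P_far : forall x i j y,
  far i j -> P (x ++ [:: j; i] ++ y) -> P (x ++ [:: i; j] ++ y).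
Hypothesis P_braid : forall x (i j : 'I_m) y, j = i.+1 :> nat ->
  P (x ++ [:: j; i; j] ++ y) -> P (x ++ i :: y) -> P (x ++ j :: y) ->
  P (x ++ [:: i; j; i] ++ y).
Hypothesis P_rot : forall x y, P (y ++ x) -> P (x ++ y).
Hypothesis P_incr : forall u, incr u -> P u.

Let P_far_word x i u y : all (far i) u ->
  P (x ++ u ++ i :: y) -> P (x ++ i :: u ++ y).
Proof.
elim: u x => [|j u IH] x //= /andP[fij fu] Pu.
apply: P_far => //; have := IH (x ++ [:: j]) fu.
by rewrite -!catA; apply.
Qed.

Let P_far_words x u w y : all (fun i => all (far i) w) u ->
  P (x ++ w ++ u ++ y) -> P (x ++ u ++ w ++ y).
Proof.
elim: u x => [|i u IH] x //= /andP[fi fu] Pu.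
have := IH (x ++ [:: i]) fu; rewrite -!catA; apply => /=.
by apply: P_far_word.
Qed.

(** Among letters that are at least [j], the letter [j] can be made to occur at
    most once.  By induction from the top, [j + 1] may be assumed to occur at
    most once between two consecutive occurrences of [j]; then the two [j] can
    be brought next to each other, or next to [j + 1] on both sides, and a
    square or a braid move lowers their number. *)
Lemma word_ind_once d (j : nat) : (j + d = m)%N ->
  forall x y z, all (fun i => j <= i)%N y ->
  (forall y', all (fun i => j <= i)%N y' ->
     (cnt j y' <= 1)%N -> P (x ++ y' ++ z)) ->
  P (x ++ y ++ z).
Proof.
elim: d j => [|d IH] j jdm x y z yj Py.
  case: y yj => [|i y] /=; first by move=> _; apply: (Py [::]).
  by case/andP; have := ltn_ord i; lia.
have [c] := ubnP (cnt j y).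
elim: c y yj => // c IHc y yj cy.
have [c1|c1] := leqP (cnt j y) 1; first exact: Py.
(* The first two occurrences of [j]. *)
have [y0 [k [y1 [l [y2 [Dy kj lj y1j]]]]]] :
    exists y0 (k : 'I_m) y1 (l : 'I_m) y2, [/\ y = y0 ++ k :: y1 ++ l :: y2,
      val k = j, val l = j & all (fun i => j < i)%N y1].
  elim: y yj c1 {cy} => [|i y IHy] //= /andP[ji yj].
  case: (ltngtP (i : nat) j) ji => // [ji|ij] _.
    rewrite add0n => /(IHy yj)[y0 [k [y1 [l [y2 [-> kj lj y1j]]]]]].
    by exists (i :: y0), k, y1, l, y2.
  rewrite add1n ltnS => c0.
  have hasj : has (fun i => val i == j) y by rewrite has_count.
  case/split_find: hasj yj => l y1 y2 /eqP lj nj.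
  rewrite cat_rcons all_cat => /andP[y1j _].
  exists [::], i, y1, l, y2; split=> //.
  apply/allP => e e1; rewrite ltn_neqAle (allP y1j _ e1) andbT eq_sym.
  by apply: contra nj => ej; apply/hasP; exists e.
have y0j : all (fun i => j <= i)%N y0 by move: yj; rewrite Dy all_cat => /andP[].
have y2j : all (fun i => j <= i)%N y2.
  by move: yj; rewrite Dy all_cat /= all_cat /= => /and5P[].
have -> : x ++ y ++ z = (x ++ y0 ++ [:: k]) ++ y1 ++ (l :: y2 ++ z).
  by rewrite Dy -!(catA, cat_cons).
apply: (IH j.+1) => //; first by lia.
move=> y1' y1'j c1'; have kl : l = k by apply/val_inj; rewrite kj.
rewrite {}kl {lj l} in Dy *.
have cy1 : cnt j y1 = 0%N.
  by apply/eqP; rewrite cnt_eq0; apply: sub_all y1j => e /=; lia.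
move: cy; rewrite Dy !(cnt_cat, cnt_cons) kj eqxx cy1 => cy.
have [c0|c0] := posnP (cnt j.+1 y1').
- (* No [j + 1] in between: the two [j] meet and cancel. *)
  have fk : all (far k) y1'.
    apply/allP => e e1; rewrite /far kj; have := allP y1'j _ e1.
    move/eqP: c0; rewrite cnt_eq0 => /allP/(_ _ e1) /=; lia.
  have -> : (x ++ y0 ++ [:: k]) ++ y1' ++ k :: y2 ++ z
          = (x ++ y0) ++ k :: y1' ++ k :: y2 ++ z by rewrite -!catA.
  apply: P_far_word => //.
  have -> : (x ++ y0) ++ y1' ++ [:: k, k & y2 ++ z]
          = (x ++ y0 ++ y1') ++ [:: k; k] ++ (y2 ++ z) by rewrite -!catA.
  apply: P_square.
  have -> : (x ++ y0 ++ y1') ++ y2 ++ z = x ++ (y0 ++ y1' ++ y2) ++ z.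
    by rewrite -!catA.
  apply: IHc.
    by rewrite !all_cat y0j y2j andbT; apply: sub_all y1'j => e /=; lia.
  rewrite !cnt_cat.
  have -> : cnt j y1' = 0%N.
    apply/eqP; rewrite eqn0Ngt -has_count -all_predC.
    by apply: sub_all y1'j => e /=; lia.
  lia.
(* Exactly one [j + 1] in between: the braid move applies to [j (j + 1) j]. *)
have hasj : has (fun i => val i == j.+1) y1' by rewrite has_count.
case/split_find: hasj y1'j c1' c0 => l a b /eqP lj na.
rewrite cat_rcons all_cat /= => /and3P[aj _ bj].
rewrite !(cnt_cat, cnt_cons) lj eqxx => c1' _.
have fark s : all (fun i => j < i)%N s -> cnt j.+1 s = 0%N ->
    all (far k) s.
  move=> sj s0; apply/allP => e es; rewrite /far kj; have := allP sj _ es.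
  move/eqP: s0; rewrite cnt_eq0 => /allP/(_ _ es) /=; lia.
have fa : all (far k) a by apply: fark => //; lia.
have fb : all (far k) b by apply: fark => //; lia.
have -> : (x ++ y0 ++ [:: k]) ++ (a ++ l :: b) ++ k :: y2 ++ z
        = (x ++ y0) ++ k :: a ++ l :: b ++ k :: y2 ++ z by rewrite -!(catA, cat_cons).
apply: P_far_word => //.
have -> : (x ++ y0) ++ a ++ k :: l :: b ++ k :: y2 ++ z
   = (x ++ y0 ++ a ++ [:: k; l]) ++ b ++ [:: k] ++ y2 ++ z by rewrite -!(catA, cat_cons).
apply: P_far_words.
  apply/allP => e eb; rewrite /= andbT; have := allP fb _ eb.
  by rewrite /far orbC.
have -> : (x ++ y0 ++ a ++ [:: k; l]) ++ [:: k] ++ b ++ y2 ++ z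
  = (x ++ y0 ++ a) ++ [:: k; l; k] ++ (b ++ y2 ++ z) by rewrite -!(catA, cat_cons).
have aj0 : all (fun i => j <= i)%N a by apply: sub_all aj => e /=; lia.
have bj0 : all (fun i => j <= i)%N b by apply: sub_all bj => e /=; lia.
have ca : cnt j a = 0%N.
  by apply/eqP; rewrite cnt_eq0; apply: sub_all aj => e /=; lia.
have cb : cnt j b = 0%N.
  by apply/eqP; rewrite cnt_eq0; apply: sub_all bj => e /=; lia.
apply: P_braid; first by rewrite lj kj.
- have -> : (x ++ y0 ++ a) ++ [:: l; k; l] ++ b ++ y2 ++ z
     = x ++ (y0 ++ a ++ [:: l; k; l] ++ b ++ y2) ++ z by rewrite -!(catA, cat_cons).
  apply: IHc; first by rewrite !all_cat /= y0j aj0 bj0 y2j (kj : k = j :> nat)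
    (lj : l = j.+1 :> nat) leqnn leqnSn.
  by rewrite !(cnt_cat, cnt_cons, cnt_nil) ca cb kj lj eqxx; lia.
- have -> : (x ++ y0 ++ a) ++ k :: b ++ y2 ++ z
     = x ++ (y0 ++ a ++ [:: k] ++ b ++ y2) ++ z by rewrite -!(catA, cat_cons).
  apply: IHc; first by rewrite !all_cat /= y0j aj0 bj0 y2j (kj : k = j :> nat) leqnn.
  by rewrite !(cnt_cat, cnt_cons, cnt_nil) ca cb kj eqxx; lia.
- have -> : (x ++ y0 ++ a) ++ l :: b ++ y2 ++ z
     = x ++ (y0 ++ a ++ [:: l] ++ b ++ y2) ++ z by rewrite -!(catA, cat_cons).
  apply: IHc; first by rewrite !all_cat /= y0j aj0 bj0 y2j (lj : l = j.+1 :> nat) leqnSn.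
  by rewrite !(cnt_cat, cnt_cons, cnt_nil) ca cb lj; lia.
Qed.

(** Once the smallest letter [j] of [h] occurs at most once, what precedes it in
    [h] commutes with [w] and can be rotated to the end; then [j] joins [w]. *)
Lemma word_ind_suffix d (j : nat) : (j + d = m)%N ->
  forall w h, incr w -> all (fun i => i < j)%N w -> all (fun i => j <= i)%N h ->
  P (w ++ h).
Proof.
elim: d j => [|d IH] j jdm w h iw wj hj.
  case: h hj => [|i h] /=; first by rewrite cats0 => _; apply: P_incr.
  by case/andP; have := ltn_ord i; lia.
rewrite -[h]cats0; apply: (word_ind_once jdm) => // h' h'j c1.
have wj1 : all (fun i => i < j.+1)%N w by apply: sub_all wj => e /=; lia.
have up s : all (fun i => j <= i)%N s -> cnt j s = 0%N ->
    all (fun i => j < i)%N s.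
  move=> sj s0; apply/allP => e es; rewrite ltn_neqAle (allP sj _ es) andbT.
  by move/eqP: s0; rewrite cnt_eq0 eq_sym => /allP/(_ _ es).
have [c0|c0] := posnP (cnt j h').
  by rewrite cats0; apply: (IH j.+1) => //; [lia|exact: up].
have hasj : has (fun i => val i == j) h' by rewrite has_count.
case/split_find: hasj h'j c1 c0 => k a b /eqP kj na.
rewrite cat_rcons all_cat /= => /and3P[aj _ bj].
rewrite !(cnt_cat, cnt_cons) kj eqxx => c1 _; rewrite cats0.
have /up aj1 : cnt j a = 0%N by lia.
have /up bj1 : cnt j b = 0%N by lia.
apply: (@P_far_words [::]).
  apply/allP => e ew; apply/allP => f fa; rewrite /far.
  have := allP wj _ ew; have := allP (aj1 aj) _ fa => /= *; lia.
rewrite /=; apply: P_rot; rewrite -catA.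
have -> : w ++ (k :: b) ++ a = (w ++ [:: k]) ++ (b ++ a) by rewrite -!catA.
apply: (IH j.+1); first by lia.
- rewrite /incr map_cat /=; move: iw wj; rewrite /incr -cat1s.
  case: w {wj1} => //= i w; rewrite cat_path /= => -> /= wj; rewrite andbT.
  rewrite last_map kj; suff: all (fun i => i < j)%N (i :: w).
    by move=> /allP; apply; exact: mem_last.
  by [].
- by rewrite all_cat wj1 /= kj ltnS leqnn.
- by rewrite all_cat aj1 ?bj1.
Qed.

(** An induction principle for traces and conjugacy classes: rotations replace
    the usual need to reach a normal form of the word itself. *)
Lemma word_ind u : P u.
Proof.
by apply: (@word_ind_suffix m 0%N _ [::] u) => //; apply/allP.
Qed.

End WordInduction.
End Words.

(** * Minimal length elements of conjugacy classes of the symmetric group *)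

Section SymmetricGroup.
Variable m : nat.
Implicit Types (u w x y z : seq 'I_m) (i j k : 'I_m).

Lemma incr_uniq u : incr u -> uniq u.
Proof.
move=> iu; rewrite -(map_inj_uniq val_inj).
exact: (sorted_uniq ltn_trans ltnn).
Qed.

Lemma sprod_cat u w : sprod (u ++ w) = (sprod u * sprod w)%g.
Proof. by rewrite /sprod big_cat. Qed.

Lemma sprod_cons i u : sprod (i :: u) = (stransp i * sprod u)%g.
Proof. by rewrite /sprod big_cons. Qed.

Lemma sprod_nil : sprod [::] = 1%g :> 'S_m.+1.
Proof. by rewrite /sprod big_nil. Qed.

Lemma stransp_sq i : (stransp i * stransp i)%g = 1%g.
Proof. exact: tperm2. Qed.

Lemma stransp_far i j : far i j ->
  (stransp i * stransp j)%g = (stransp j * stransp i)%g.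
Proof.
move=> fij; apply/esym; rewrite conjgC; congr (_ * _)%g.
have ne (a b : 'I_m.+1) : val a <> val b -> a != b.
  by move=> ab; apply/eqP => /(congr1 val).
move: fij; rewrite /far /stransp tpermJ => fij.
by congr tperm; apply: tpermD; apply: ne; rewrite /= /bump /=; lia.
Qed.

Lemma stransp_braid (i j : 'I_m) : j = i.+1 :> nat ->
  (stransp i * stransp j * stransp i = stransp j * stransp i * stransp j)%g.
Proof.
move=> ji; have Ej : ix0 j = ix1 i by apply/val_inj; rewrite /= /bump; lia.
have ne (a b : 'I_m.+1) : val a <> val b -> a != b.
  by move=> ab; apply/eqP => /(congr1 val).
have conjE (a b : 'S_m.+1) : (a * a = 1)%g -> (a * b * a = b ^ a)%g.
  move=> aa; rewrite conjgE -mulgA; congr (_ * _)%g.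
  by apply/esym/eqP; rewrite eq_invg_mul aa.
rewrite !conjE ?stransp_sq // /stransp !tpermJ -Ej !(tpermL, tpermR).
by congr tperm; [apply/esym|]; apply: tpermD; apply: ne; rewrite /= /bump /=; lia.
Qed.

(** The moves of [word_ind] never introduce new letters, so the minimal length in
    a conjugacy class is at most the number of distinct letters of any word of
    any of its members. *)
Lemma sprod_conj_incr u : exists u' g,
  [/\ incr u', {subset u' <= u} & sprod u' = (sprod u ^ g)%g].
Proof.
apply: (@word_ind _ (fun u => exists u' g,
  [/\ incr u', {subset u' <= u} & sprod u' = (sprod u ^ g)%g])) => {u}.
- move=> x i y [u' [g [iu su Eu]]]; exists u', g; split=> //.
    by move=> k /su; rewrite !mem_cat => /orP[] ->; rewrite ?orbT.
  by rewrite Eu !(sprod_cat, sprod_cons, sprod_nil) mulg1 stransp_sq mul1g.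
- move=> x i j y fij [u' [g [iu su Eu]]]; exists u', g; split=> //.
    by move=> k /su; rewrite !(mem_cat, inE) (orbC (k == j)).
  by rewrite Eu !(sprod_cat, sprod_cons, sprod_nil) !mulg1 (stransp_far fij).
- move=> x i j y ji [u' [g [iu su Eu]]] _ _; exists u', g; split=> //.
    move=> k /su; rewrite !(mem_cat, inE).
    by case: (k == j); case: (k == i); rewrite ?orbT.
  rewrite Eu !(sprod_cat, sprod_cons, sprod_nil) !mulg1 !mulgA.
  by rewrite -!(mulgA (sprod x)) (stransp_braid ji).
- move=> x y [u' [g [iu su Eu]]]; exists u', ((sprod y)^-1 * g)%g; split=> //.
    by move=> k /su; rewrite !mem_cat orbC.
  by rewrite Eu conjgM !sprod_cat; congr (_ ^ g)%g; rewrite conjgE invgK !mulgA mulgK.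
- by move=> u iu; exists u, 1%g; split; rewrite ?conjg1.
Qed.

Lemma coxeter_length_sprod u : (coxeter_length (sprod u) <= size u)%N.
Proof.
rewrite /coxeter_length; case: ex_minnP => k _; apply.
by apply/existsP; exists (in_tuple u).
Qed.

(** The word [u] is conjugate to an increasing word [u'] in the letters of [u].
    Minimality of the length leaves no room for [u'] to be shorter than [u], so
    [u] has as many distinct letters as letters. *)
Lemma minimal_length_uniq (C : {set 'S_m.+1}) w u :
  C \in classes [set: 'S_m.+1] -> minimal_length_in C (sprod w) ->
  reduced_expression (sprod w) u -> uniq u.
Proof.
case/imsetP=> g0 _ ->; case=> wC wmin [Eu su].
have [u' [g [iu' su' Eu']]] := sprod_conj_incr u.
have u'C : sprod u' \in (g0 ^: [set: 'S_m.+1])%g.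
  by move: wC => /class_eqP <-; rewrite Eu' Eu memJ_class ?inE.
have le1 := leq_trans (wmin _ u'C) (coxeter_length_sprod u').
have le2 : (size u' <= size (undup u))%N.
  by apply: uniq_leq_size (incr_uniq iu') _ => k /su'; rewrite mem_undup.
rewrite -[uniq u]negbK -ltn_size_undup -leqNgt.
by rewrite su (leq_trans le1 le2).
Qed.

End SymmetricGroup.

(** * Algebras given by generators and relations *)

Section PresentedAlgebra.
Variables (K : comNzRingType) (P : presentation K).
Implicit Types (x y : palg P) (a b : K).

Lemma pclsD (s t : pterm K (pgen P)) : pcls (s + t)%PT = pcls s + pcls t.
Proof. by rewrite /GRing.add /= paddE. Qed.

Lemma pclsM (s t : pterm K (pgen P)) : pcls (s * t)%PT = pcls s * pcls t.
Proof. by rewrite /GRing.mul /= pmulE. Qed.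

Lemma pcls_scale a (t : pterm K (pgen P)) : pcls (Cst a * t)%PT = a *: pcls t.
Proof. by rewrite /GRing.scale /= pscaleE. Qed.

Lemma pcls1 : pcls (Cst 1) = 1 :> palg P.
Proof. by []. Qed.

Lemma pclsC a : pcls (Cst a) = a *: (1 : palg P).
Proof. by rewrite -pcls1 -pcls_scale; apply/pclsP/CgSym/CgMul1r. Qed.

Lemma palg_scaleAl a x y : a *: (x * y) = a *: x * y.
Proof.
rewrite -(pclsK x) -(pclsK y) -!(pclsM, pcls_scale).
by apply/pclsP; exact: CgMulA.
Qed.

Lemma palg_scaleAr a x y : a *: (x * y) = x * (a *: y).
Proof.
rewrite -(pclsK x) -(pclsK y) -!(pclsM, pcls_scale); apply/pclsP.
apply: CgTrans (CgMulA _ _ _) _; apply: CgTrans (CgSym (CgMulA _ _ _)).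
by apply: CgMul (CgCstC _ _) (CgRefl _).
Qed.

Lemma palg_ind (Q : palg P -> Prop) :
  (forall g, Q (pelt g)) -> (forall a, Q (a *: (1 : palg P))) ->
  (forall x y, Q x -> Q y -> Q (x + y)) ->
  (forall x y, Q x -> Q y -> Q (x * y)) -> forall x, Q x.
Proof.
move=> Qg QC QD QM x; rewrite -(pclsK x).
elim: (repr x) => [g|a|s Qs t Qt|s Qs t Qt].
- exact: Qg.
- by rewrite pclsC.
- by rewrite pclsD; exact: QD.
- by rewrite pclsM; exact: QM.
Qed.

Lemma palg_relP (s t : pterm K (pgen P)) : prel s t -> pcls s = pcls t.
Proof. by move=> st; apply/pclsP; exact: CgRel. Qed.

Lemma homog_decomp x : (forall g : pgen P, exists b : bool, pdeg g b) ->
  exists x0 x1 : palg P, [/\ homog false x0, homog true x1 & x = x0 + x1].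
Proof.
move=> gdeg; elim/palg_ind: x => [g|a|x y|x y].
- have [[] gb] := gdeg g.
  + exists 0, (pelt g); split; rewrite ?add0r //; [exact: Homog0|exact: HomogGen].
  + exists (pelt g), 0; split; rewrite ?addr0 //; [exact: HomogGen|exact: Homog0].
- exists (a *: (1 : palg P)), 0; split; rewrite ?addr0 //; last exact: Homog0.
  by apply: HomogZ; exact: Homog1.
- move=> [x0 [x1 [hx0 hx1 ->]]] [y0 [y1 [hy0 hy1 ->]]].
  by exists (x0 + y0), (x1 + y1); split; [exact: HomogD|exact: HomogD|rewrite addrACA].
- move=> [x0 [x1 [hx0 hx1 ->]]] [y0 [y1 [hy0 hy1 ->]]].
  exists (x0 * y0 + x1 * y1), (x0 * y1 + x1 * y0).
  split; [| |by rewrite mulrDl !mulrDr [x1 * y0 + _]addrC addrACA].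
    by apply: HomogD; [exact: (HomogM hx0 hy0)|exact: (HomogM hx1 hy1)].
  by apply: HomogD; [exact: (HomogM hx0 hy1)|exact: (HomogM hx1 hy0)].
Qed.

(* The structure map of a target [K]-algebra is an arbitrary central ring
   morphism, so that matrix rings over presented algebras are covered. *)
Section UniversalProperty.
Variables (M : pzRingType) (iota : K -> M) (f : pgen P -> M).
Hypothesis iotaD : {morph iota : a b / a + b}.
Hypothesis iotaM : {morph iota : a b / a * b}.
Hypothesis iota1 : iota 1 = 1.
Hypothesis iota_central : forall a X, iota a * X = X * iota a.

Fixpoint peval (t : pterm K (pgen P)) : M :=
  match t with
  | Gen g => f g
  | Cst a => iota a
  | Add s t => peval s + peval t
  | Mul s t => peval s * peval t
  end.

Hypothesis f_rel : forall s t, prel s t -> peval s = peval t.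

Let iota0 : iota 0 = 0.
Proof. by apply: (addrI (iota 0)); rewrite -iotaD !addr0. Qed.

Lemma peval_congr s t : congr s t -> peval s = peval t.
Proof.
elim=> //=.
- by move=> x y z _ -> _ ->.
- by move=> x x' y y' _ -> _ ->.
- by move=> x x' y y' _ -> _ ->.
- by move=> *; rewrite addrA.
- by move=> *; rewrite addrC.
- by move=> *; rewrite iota0 add0r.
- by move=> *; rewrite mulrA.
- by move=> *; rewrite iota1 mul1r.
- by move=> *; rewrite iota1 mulr1.
- by move=> *; rewrite iota0 mul0r.
- by move=> *; rewrite mulrDl.
- by move=> *; rewrite mulrDr.
Qed.

Definition plift x : M := peval (repr x).

Lemma plift_cls t : plift (pcls t) = peval t.
Proof. exact: peval_congr (repr_congr t). Qed.

Lemma plift_gen g : plift (pelt g) = f g.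
Proof. by rewrite plift_cls. Qed.

Lemma plift1 : plift 1 = 1.
Proof. by rewrite -pcls1 plift_cls. Qed.

Lemma pliftD : {morph plift : x y / x + y}.
Proof. by move=> x y; rewrite -(pclsK x) -(pclsK y) -pclsD !plift_cls. Qed.

Lemma pliftM : {morph plift : x y / x * y}.
Proof. by move=> x y; rewrite -(pclsK x) -(pclsK y) -pclsM !plift_cls. Qed.

Lemma pliftZ a x : plift (a *: x) = iota a * plift x.
Proof. by rewrite -(pclsK x) -pcls_scale !plift_cls. Qed.

Lemma plift0 : plift 0 = 0.
Proof. by rewrite -(scale0r 0) pliftZ iota0 mul0r. Qed.

Lemma plift_supercomm (N : M) (c : bool) :
  (forall g (b : bool), pdeg g b -> N * f g = (-1) ^+ (c && b) * (f g * N)) ->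
  forall (b : bool) x, homog b x -> N * plift x = (-1) ^+ (c && b) * (plift x * N).
Proof.
move=> Nf b x; elim=> {b x}.
- by move=> b; rewrite plift0 !(mulr0, mul0r).
- by move=> b x y _ Nx _ Ny; rewrite pliftD mulrDr Nx Ny mulrDl mulrDr.
- move=> b a x _ Nx; rewrite pliftZ mulrA -iota_central -mulrA Nx -!mulrA.
  by rewrite !mulrA iota_central.
- by rewrite plift1 andbF expr0 !(mulr1, mul1r).
- by move=> b g gb; rewrite plift_gen; exact: Nf.
- move=> b b' x y _ Nx _ Ny; rewrite pliftM mulrA Nx -!mulrA Ny.
rewrite (mulrA (plift x) ((-1) ^+ _)) (commr_sign (plift x)) -!mulrA mulrA -signr_addb.
  by case: c b b' {Nx Ny Nf} => [] [] [].
Qed.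

End UniversalProperty.

Section Trace.
Variables (phi : palg P -> K) (tr_phi : trace_function phi).

Lemma traceZ a x : phi (a *: x) = a * phi x.
Proof.
have [lin _ _] := tr_phi; have := lin a x 0; rewrite addr0 => ->.
have := lin (-1) 0 0; rewrite scaler0 addr0 mulN1r addNr => ->.
by rewrite addr0.
Qed.

Lemma traceD x y : phi (x + y) = phi x + phi y.
Proof. by have [lin _ _] := tr_phi; rewrite -[x]scale1r lin mul1r scale1r. Qed.

Lemma trace0 : phi 0 = 0.
Proof. by rewrite -(scale0r 0) traceZ mul0r. Qed.

Lemma traceN x : phi (- x) = - phi x.
Proof. by rewrite -scaleN1r traceZ mulN1r. Qed.

Lemma trace_comm x y : phi (x * y) = phi (y * x).
Proof. by have [_ cyc _] := tr_phi. Qed.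

Lemma trace_odd x : homog true x -> phi x = 0.
Proof. by have [_ _] := tr_phi; apply. Qed.

End Trace.
End PresentedAlgebra.

(** * Extending a trace from the spin Hecke algebra to the super tensor product *)

(** The matrix model of the Clifford algebra, built by doubling the size: the
    next generator exchanges the two halves, and the earlier ones act with
    opposite signs on them.  The index parity [p] makes every generator odd. *)
Lemma anticommuting_matrices (A : pzRingType) n :
  exists N (p : 'I_N -> bool) (g : nat -> 'M[A]_N),
    [/\ (0 < N)%N,
        forall i, (i < n)%N -> g i *m g i = 1%:M,
        forall i j, (i < n)%N -> (j < n)%N -> i != j ->
          g i *m g j = - (g j *m g i),
        forall i a b, (i < n)%N -> p a = p b -> g i a b = 0
      & forall i a b, (i < n)%N -> exists z : int, g i a b = z%:~R].
Proof.
elim: n => [|n [N [p [g [N0 gsq ganti gp gZ]]]]].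
  by exists 1%N, (fun=> false), (fun=> 0).
pose g' i : 'M[A]_(N + N) :=
  if (i < n)%N then block_mx (g i) 0 0 (- g i) else block_mx 0 1%:M 1%:M 0.
pose p' k := match split k with inl a => p a | inr b => ~~ p b end.
have p'l a : p' (lshift N a) = p a by rewrite /p' (unsplitK (inl a)).
have p'r a : p' (rshift N a) = ~~ p a by rewrite /p' (unsplitK (inr a)).
exists (N + N)%N, p', g'; split=> [|i _|i j ii jj ij|i a b _|i a b _].
- by rewrite addn_gt0 N0.
- rewrite /g'; case: ifP => [ii|_]; rewrite mulmx_block !(mul0mx, mulmx0, mul1mx).
    by rewrite mulNmx mulmxN opprK gsq // !(addr0, add0r) -scalar_mx_block.
  by rewrite !(addr0, add0r) -scalar_mx_block.
- rewrite /g'; case: ifP => iin; case: ifP => jn; last by lia.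
  + rewrite !mulmx_block !(mul0mx, mulmx0, addr0, add0r, mulNmx, mulmxN, opprK).
    by rewrite opp_block_mx !oppr0 (ganti i j).
  + rewrite !mulmx_block !(mul0mx, mulmx0, mul1mx, mulmx1, addr0, add0r).
    by rewrite opp_block_mx !oppr0 opprK.
  + rewrite !mulmx_block !(mul0mx, mulmx0, mul1mx, mulmx1, addr0, add0r).
    by rewrite opp_block_mx !oppr0 opprK.
- rewrite -(splitK a) -(splitK b) /g'.
  case: (split a) (split b) => [a'|a'] [b'|b'] /=; rewrite !(p'l, p'r);
    case: ifP => ii; rewrite ?(block_mxEul, block_mxEur, block_mxEdl, block_mxEdr)
      ?mxE //; try by move=> pp; rewrite ?gp ?oppr0 //; apply: (can_inj negbK).
  + by case: eqP => // ->; case: (p _).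
  + by case: eqP => // ->; case: (p _).
- rewrite -(splitK a) -(splitK b) /g'.
  case: (split a) (split b) => [a'|a'] [b'|b'] /=;
    case: ifP => ii; rewrite ?(block_mxEul, block_mxEur, block_mxEdl, block_mxEdr)
      ?mxE //; try by exists 0.
  + exact: gZ.
  + by exists (nat_of_bool (a' == b')).
  + by exists (nat_of_bool (a' == b')).
  + by have [z ->] := gZ i a' b' ii; exists (- z); rewrite mulrNz.
Qed.

Section ExtendTrace.
Variables (K : fieldType) (v : K) (m : nat).
Hypothesis K_char0 : forall n, n.+1%:R != 0 :> K.

Local Notation A := (palg (spin_hecke v m)).
Local Notation C := (palg (clifford K m)).
Local Notation S := (palg (stensor (spin_hecke v m) (clifford K m))).

Variables (tau : A -> K) (tr_tau : trace_function tau).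

Variables (N : nat) (p : 'I_N -> bool) (g : nat -> 'M[A]_N).
Hypotheses (N0 : (0 < N)%N)
  (gsq : forall i, (i < m.+1)%N -> g i *m g i = 1%:M)
  (ganti : forall i j, (i < m.+1)%N -> (j < m.+1)%N -> i != j ->
          g i *m g j = - (g j *m g i))
  (gp : forall i a b, (i < m.+1)%N -> p a = p b -> g i a b = 0)
  (gZ : forall i a b, (i < m.+1)%N -> exists z : int, g i a b = z%:~R).

Let gC (j : 'I_m.+1) a b x : g j a b * x = x * g j a b.
Proof. by have [z ->] := gZ a b (ltn_ord j); rewrite mulrzl mulrzr. Qed.

Let iota (a : K) : 'M[A]_N := (a *: (1 : A))%:M.

Let iotaD : {morph iota : a b / a + b}.
Proof. by move=> a b; rewrite /iota scalerDl raddfD. Qed.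

Let iotaM : {morph iota : a b / a * b}.
Proof.
move=> a b; rewrite /iota -[LHS]/(scalar_mx _) -[RHS]/(_ *m _) -scalar_mxM.
by rewrite -palg_scaleAl mul1r scalerA.
Qed.

Let iota1 : iota 1 = 1.
Proof. by rewrite /iota scale1r. Qed.

Let iota_mulE a (X : 'M[A]_N) i j : (iota a * X) i j = a *: X i j.
Proof.
rewrite -[_ * X]/(_ *m _) mxE (bigD1 i) //= big1 => [|k ki].
  by rewrite addr0 mxE eqxx mulr1n -palg_scaleAl mul1r.
by rewrite mxE eq_sym (negPf ki) mulr0n mul0r.
Qed.

Let iota_central a X : iota a * X = X * iota a.
Proof.
apply/matrixP => i j; rewrite iota_mulE -[X * _]/(_ *m _) mxE (bigD1 j) //= big1.
  by rewrite addr0 mxE eqxx mulr1n -palg_scaleAr mulr1.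
by move=> k kj; rewrite mxE (negPf kj) mulr0n mulr0.
Qed.

(** The twisted diagonal embedding: odd elements acquire the sign of the
    grading of the index, so that they anticommute with the matrices [g]. *)
Let twist (x : A) : 'M[A]_N := diag_mx (\row_i ((-1) ^+ p i * x)).

Let twistM3 x y z : twist x * twist y * twist z = twist (x * y * z).
Proof.
rewrite -[LHS]/(_ *m _ *m _) !mulmx_diag; congr diag_mx.
apply/rowP => i; rewrite !mxE.
by case: (p i); rewrite /= !(mulN1r, mul1r) ?mulrNN ?mulrN ?mulNr.
Qed.

Let twistM2 x y : twist x * twist y = (x * y)%:M.
Proof.
rewrite -[LHS]/(_ *m _) mulmx_diag -diag_const_mx; congr diag_mx.
by apply/rowP => i; rewrite !mxE; case: (p i); rewrite /= !(mulN1r, mul1r) ?mulrNN.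
Qed.

Let twistB x y : twist (x - y) = twist x - twist y.
Proof.
by rewrite /twist -raddfB; congr diag_mx; apply/rowP => i; rewrite !mxE mulrBr.
Qed.

Let twistZ a x : twist (a *: x) = iota a * twist x.
Proof.
apply/matrixP => i j; rewrite iota_mulE !mxE.
by case: eqP => _; rewrite ?mulr0n ?scaler0 // !mulr1n palg_scaleAr.
Qed.

Let lgen (i : pgen (spin_hecke v m)) : 'M[A]_N := twist (shR v i).

Let lrel (s t : pterm K (pgen (spin_hecke v m))) : prel s t ->
  peval iota lgen s = peval iota lgen t.
Proof.
have iotaN (X : 'M[A]_N) : iota (- 1) * X = - X.
  by apply/matrixP => i j; rewrite iota_mulE scaleN1r mxE.
have R (s' t' : pterm K 'I_m) : spin_hecke_rel v s' t' ->
    pcls (P := spin_hecke v m) s' = pcls (P := spin_hecke v m) t'.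
  exact: (@palg_relP _ (spin_hecke v m)).
case=> [i|i j fij|i j ji] /=; rewrite /lgen.
- by have := R _ _ (SHquad v i); rewrite pclsM pclsC twistM2 => ->.
- have := R _ _ (SHfar v fij); rewrite pcls_scale !pclsM scaleN1r.
  by rewrite iotaN !twistM2 -raddfN => ->.
- have := R _ _ (SHbraid v ji); rewrite !(pcls_scale, pclsD, pclsM) !scaleN1r.
  by rewrite !iotaN !twistM3 -!twistB -twistZ => ->.
Qed.

Let lrep : A -> 'M[A]_N := plift iota lgen.

Let lrep_homog (b : bool) x : homog b x ->
  lrep x = diag_mx (\row_i ((-1) ^+ (b && p i) * x)).
Proof.
elim=> {b x}.
- move=> b; rewrite /lrep plift0 //; apply/esym/matrixP => i j.
  by rewrite !mxE mulr0 mul0rn.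
- move=> b x y _ Nx _ Ny; rewrite /lrep pliftD // -!/(lrep _) Nx Ny -raddfD.
  by congr diag_mx; apply/rowP => i; rewrite !mxE mulrDr.
- move=> b a x _ Nx; rewrite /lrep pliftZ // -/(lrep _) Nx.
  apply/matrixP => i j; rewrite iota_mulE !mxE.
  by case: eqP => _; rewrite ?mulr0n ?scaler0 // !mulr1n palg_scaleAr.
- rewrite /lrep plift1 // -[LHS]/(1%:M) -diag_const_mx; congr diag_mx.
  by apply/rowP => i; rewrite !mxE mulr1.
- move=> b i /= ->; rewrite /lrep plift_gen //; congr diag_mx.
- move=> b c x y _ Nx _ Ny; rewrite /lrep pliftM // -!/(lrep _) Nx Ny.
  rewrite -[LHS]/(_ *m _) mulmx_diag; congr diag_mx.
  apply/rowP => i; rewrite !mxE {Nx Ny}; case: b c (p i) => [] [] [] /=;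
  by rewrite ?(mulN1r, mul1r) ?mulrNN ?mulrN ?mulNr ?expr0 ?mul1r.
Qed.

Let rgen (j : pgen (clifford K m)) : 'M[A]_N := g (val j).

Let rrel (s t : pterm K (pgen (clifford K m))) : prel s t ->
  peval iota rgen s = peval iota rgen t.
Proof.
case=> [j|j k jk] /=; rewrite /rgen.
- by rewrite iota1; apply: (gsq (ltn_ord j)).
- have -> (X : 'M[A]_N) : iota (- 1) * X = - X.
    by apply/matrixP => i i'; rewrite iota_mulE scaleN1r mxE.
  exact: (ganti (ltn_ord j) (ltn_ord k)).
Qed.

Let rrep : C -> 'M[A]_N := plift iota rgen.

Let sgen (z : A + C) : 'M[A]_N :=
  match z with inl x => lrep x | inr y => rrep y end.

Let twist_g x (j : 'I_m.+1) : twist x * g j = - (g j * twist x).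
Proof.
apply/matrixP => a b; rewrite -[twist x * _]/(_ *m _) -[g j * _]/(_ *m _).
rewrite mul_diag_mx mul_mx_diag !mxE -gC.
have [pab|pab] := eqVneq (p a) (p b); first by rewrite gp ?ltn_ord // !mul0r oppr0.
have -> : p a = ~~ p b by case: (p a) (p b) pab => [] [].
by case: (p b); rewrite /= ?(mulN1r, mul1r) ?mulrN ?opprK.
Qed.

Let srel (s t : pterm K (A + C)) : stensor_rel s t ->
  peval (P := stensor _ _) iota sgen s = peval (P := stensor _ _) iota sgen t.
Proof.
have [l r] := (lrel, rrel).
case=> [x y|a x|x y||x y|a x|x y||b c x y hx hy] /=;
  do ?[by rewrite /lrep ?(pliftD, pliftM, pliftZ, plift1)
      |by rewrite /rrep ?(pliftD, pliftM, pliftZ, plift1)].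
have lx (j : 'I_m.+1) : g j * lrep x = (-1) ^+ b * (lrep x * g j).
  rewrite -[b]andTb; apply: (plift_supercomm (P := spin_hecke v m)) hx => //.
  by move=> i b' /= ->; rewrite expr1 mulN1r twist_g opprK.
have -> : iota ((-1) ^+ (b && c)) = (-1) ^+ (b && c).
  case: (b && c); rewrite ?expr0 ?iota1 // !expr1; apply/matrixP=> i j.
  by rewrite -[iota _]mulr1 iota_mulE scaleN1r [RHS]mxE.
have := @plift_supercomm _ (clifford K m) _ iota rgen iotaD iotaM iota1
  iota_central rrel (lrep x) b _ c y hy.
rewrite -/(rrep y) => ->; first by rewrite mulrA -signr_addb addbb mul1r.
by move=> j c' /= ->; rewrite lx andbT mulrA -signr_addb addbb mul1r.
Qed.

Let srep : S -> 'M[A]_N := plift (P := stensor _ _) iota sgen.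

(* Parity of a matrix: the parity of an entry is corrected by the parities of its
   row and column. *)
Let graded (b : bool) (X : 'M[A]_N) := forall i j, homog (b (+) p i (+) p j) (X i j).

Let graded_plift (P : presentation K) (f : pgen P -> 'M[A]_N)
    (frel : forall s t, prel s t -> peval iota f s = peval iota f t) :
  (forall x b, pdeg x b -> graded b (f x)) ->
  forall (b : bool) x, homog b x -> graded b (plift iota f x).
Proof.
move=> fP b x; elim=> {b x}.
- by move=> b i j; rewrite plift0 // mxE; exact: Homog0.
- by move=> b x y _ Nx _ Ny i j; rewrite pliftD // mxE; exact: HomogD.
- by move=> b a x _ Nx i j; rewrite pliftZ // iota_mulE; exact: HomogZ.
- move=> i j; rewrite plift1 // mxE; case: eqP => [->|_]; last exact: Homog0.
  by rewrite addFb addbb; exact: Homog1.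
- by move=> b x bx; rewrite plift_gen //; exact: fP.
- move=> b c x y _ Nx _ Ny i j; rewrite pliftM // -[_ * _]/(_ *m _) mxE.
  elim/big_ind: _ => [|X Y|k _]; [exact: Homog0|exact: HomogD|].
  have -> : b (+) c (+) p i (+) p j = (b (+) p i (+) p k) (+) (c (+) p k (+) p j).
    by case: b c (p i) (p j) (p k) {Nx Ny} => [] [] [] [] [].
  exact: HomogM.
Qed.

Let graded_srep (b : bool) z : homog b z -> graded b (srep z).
Proof.
apply: (graded_plift (P := stensor _ _) srel).
have diag (d : 'I_N -> A) c : (forall i, homog c (d i)) ->
    graded c (diag_mx (\row_i d i)).
  move=> dc i j; rewrite !mxE; case: eqP => [->|_]; last exact: Homog0.
  by rewrite addbK mulr1n.
case=> [x|y] {}b /=.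
  apply: (graded_plift lrel).
  move=> i c /= ->; apply: diag => j.
  rewrite -[true]addFb; apply: HomogM; last exact: HomogGen.
  by case: (p j); rewrite ?expr1 -?scaleN1r; try apply: HomogZ; exact: Homog1.
apply: (graded_plift rrel).
move=> j c /= -> a a'; have [pa|pa] := eqVneq (p a) (p a').
  by rewrite gp ?ltn_ord //; exact: Homog0.
have [n ->] := gZ a a' (ltn_ord j).
have -> : true (+) p a (+) p a' = false by case: (p a) (p a') pa => [] [].
by rewrite -[_%:~R]/(1 *~ n) -(@scaler_int K); apply: HomogZ; exact: Homog1.
Qed.

Let srep_homog_l x : srep (pure_tensor x 1) = lrep x.
Proof.
rewrite /srep /pure_tensor pliftM ?plift_gen //; try exact: srel.
by rewrite /= /rrep plift1 ?mulr1 //; exact: rrel.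
Qed.

(* For even [x] the diagonal entries of [lrep x] all equal [x], hence the factor;
   for odd [x] they are [x] up to sign, and [tau] kills them. *)
Let strace (z : S) : K := N%:R^-1 * tau (\tr (srep z)).

Lemma trace_function_strace : trace_function strace.
Proof.
have s1 := srel; split=> [a x y|x y|z /graded_srep z1]; rewrite /strace.
- rewrite /srep pliftD // pliftZ // mxtraceD (traceD tr_tau) mulrDr; congr (_ + _).
  rewrite mulrCA; congr (_ * _); rewrite -(traceZ tr_tau); congr tau.
  by rewrite /mxtrace scaler_sumr; apply: eq_bigr => i _; rewrite iota_mulE.
- congr (_ * _); rewrite /srep !pliftM // /mxtrace.
  have tau_sum I r (F : I -> A) : tau (\sum_(i <- r) F i) = \sum_(i <- r) tau (F i).
    elim: r => [|i r IH]; first by rewrite !big_nil (trace0 tr_tau).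
    by rewrite !big_cons (traceD tr_tau) IH.
  rewrite !tau_sum.
  under eq_bigr => i _ do rewrite -[_ * _]/(_ *m _) mxE tau_sum.
  under [RHS]eq_bigr => i _ do rewrite -[_ * _]/(_ *m _) mxE tau_sum.
  rewrite exchange_big; apply: eq_bigr => i _; apply: eq_bigr => j _.
  exact: trace_comm.
- rewrite (trace_odd tr_tau) ?mulr0 //; apply: (big_ind (homog true)).
  + exact: Homog0.
  + by move=> *; exact: HomogD.
  + by move=> i _; have := z1 i i; rewrite addbK.
Qed.

Lemma strace_l x : strace (pure_tensor x 1) = tau x.
Proof.
rewrite /strace srep_homog_l.
have [|x0 [x1 [hx0 hx1 ->]]] := homog_decomp x; first by move=> ?; exists true.
have l := lrel; rewrite [lrep _]pliftD // -!/(lrep _).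
rewrite mxtraceD (lrep_homog hx0) (lrep_homog hx1) !mxtrace_diag !(traceD tr_tau).
rewrite [tau x1](trace_odd tr_tau) // addr0.
rewrite [X in _ + X](trace_odd tr_tau) ?addr0.
  under eq_bigr do rewrite mxE /= expr0 mul1r.
  rewrite sumr_const card_ord -(@scaler_nat K) (traceZ tr_tau) mulKf //.
  by rewrite -(prednK N0).
apply: (big_ind (homog true)); [exact: Homog0|by move=> *; exact: HomogD|].
move=> i _; rewrite mxE; case: (p i); rewrite /= ?mul1r //.
by rewrite expr1 mulN1r -scaleN1r; exact: HomogZ.
Qed.

End ExtendTrace.

(** The super tensor product acts by matrices over the spin Hecke algebra: [R_i]
    through a diagonal matrix with entries [R_i] and [- R_i], and the Clifford
    generators through integer matrices that exchange the two signs.  The matrix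
    trace followed by [tau], suitably normalized, is the extension. *)
Lemma extend_trace (K : fieldType) (v : K) m
    (tau : palg (spin_hecke v m) -> K) :
  (forall n, n.+1%:R != 0 :> K) -> trace_function tau ->
  exists t : palg (stensor (spin_hecke v m) (clifford K m)) -> K,
    trace_function t /\ forall h, t (pure_tensor h 1) = tau h.
Proof.
move=> K0 tr_tau.
have [N [p [g [N0 gsq ganti gp gZ]]]] :=
  anticommuting_matrices (palg (spin_hecke v m)) m.+1.
eexists; split; first exact: (trace_function_strace tr_tau gsq ganti gp gZ).
exact: (strace_l K0 tr_tau N0 gsq ganti gp gZ).
Qed.

(** * Traces on Hecke algebras and permutation of blocks *)

Lemma adjacent_swap_perm (T : eqType) (V : Type) (f : seq T -> V) (s0 : seq T) :
  (forall x a b y, perm_eq (x ++ a :: b :: y) s0 ->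
     f (x ++ a :: b :: y) = f (x ++ b :: a :: y)) ->
  forall s, perm_eq s s0 -> f s = f s0.
Proof.
move=> fswap.
have move_front x y a z : perm_eq (x ++ y ++ a :: z) s0 ->
    f (x ++ y ++ a :: z) = f (x ++ a :: y ++ z).
  elim: y x => [|b y IH] x //= ps.
  have -> : x ++ b :: y ++ a :: z = (x ++ [:: b]) ++ y ++ a :: z by rewrite -catA.
  rewrite IH -?catA //= fswap //; apply: perm_trans ps.
  by rewrite perm_cat2l perm_cons -cat1s perm_catCA.
suff gen s' s x : perm_eq s s' -> perm_eq (x ++ s) s0 -> f (x ++ s) = f (x ++ s').
  by move=> s ss; exact: (gen s0 s [::]).
elim: s' s x => [|b s' IH] s x ps pxs; first by move/perm_nilP: ps => ->.
have bs : b \in s by rewrite (perm_mem ps) inE eqxx.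
case/splitPr: bs ps pxs => y z ps pxs.
rewrite move_front //.
have pyz : perm_eq (y ++ z) s'.
  by rewrite -(perm_cons b) -(permPr ps) -cat1s perm_catCA.
have -> : x ++ b :: y ++ z = (x ++ [:: b]) ++ (y ++ z) by rewrite -catA.
rewrite IH -?catA //; apply: perm_trans pxs.
by rewrite perm_cat2l -[b :: z]cat1s perm_catCA.
Qed.

Lemma gamma_word_from_cat a g1 g2 : gamma_word_from a (g1 ++ g2) =
  gamma_word_from a g1 ++ gamma_word_from (a + sumn g1) g2.
Proof.
elim: g1 a => [|g g1 IH] a /=; first by rewrite addn0.
by rewrite IH -catA addnA.
Qed.

Lemma gamma_word_from_bounds a g :
  all (fun i => (a <= i) && (i.+1 < a + sumn g))%N (gamma_word_from a g).
Proof.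
elim: g a => [|g gs IH] a //=; rewrite all_cat; apply/andP; split.
  by apply/allP => i; rewrite mem_iota; lia.
by apply: sub_all (IH (a + g)%N) => i /=; lia.
Qed.

Section BlockSwap.
Variables (A : pzRingType) (T : nat -> A) (m : nat).
Hypothesis T_far : forall i j, (i.+1 < j < m)%N -> T i * T j = T j * T i.
Hypothesis T_braid : forall i, (i.+1 < m)%N ->
  T i * T i.+1 * T i = T i.+1 * T i * T i.+1.
Hypothesis T_inv : forall i, (i < m)%N -> exists T', T i * T' = 1 /\ T' * T i = 1.

Definition Tword (s : seq nat) : A := \prod_(i <- s) T i.

Lemma Tword_cat s1 s2 : Tword (s1 ++ s2) = Tword s1 * Tword s2.
Proof. exact: big_cat. Qed.

Lemma Tword_cons i s : Tword (i :: s) = T i * Tword s.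
Proof. exact: big_cons. Qed.

Lemma Tword_nil : Tword [::] = 1.
Proof. exact: big_nil. Qed.

Lemma Tword_inv s : all (fun i => i < m)%N s ->
  exists X, Tword s * X = 1 /\ X * Tword s = 1.
Proof.
elim: s => [_|i s IH /= /andP[im /IH[X [sX Xs]]]].
  by exists 1; rewrite Tword_nil mulr1.
have [T' [TT' T'T]] := T_inv im; exists (X * T'); rewrite Tword_cons.
split; first by rewrite mulrA -(mulrA (T i)) sX mulr1.
by rewrite mulrA -(mulrA X) T'T mulr1.
Qed.

Lemma Tword_far i s : (i < m)%N ->
  all (fun j => (j < m) && ((i.+1 < j) || (j.+1 < i)))%N s ->
  T i * Tword s = Tword s * T i.
Proof.
move=> im; elim: s => [|j s IH] /=; first by rewrite Tword_nil mulr1 mul1r.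
case/andP=> /andP[jm fij] fs; rewrite Tword_cons -mulrA -IH // !mulrA.
congr (_ * _); case/orP: fij => [ij|ji]; first by apply: T_far; rewrite ij.
by apply/esym/T_far; rewrite ji.
Qed.

Lemma Tword_far_word s1 s2 : all (fun i => i < m)%N s1 ->
  all (fun i => all (fun j => (j < m) && ((i.+1 < j) || (j.+1 < i))) s2)%N s1 ->
  Tword s1 * Tword s2 = Tword s2 * Tword s1.
Proof.
elim: s1 => [|i s IH] /=; first by rewrite Tword_nil mulr1 mul1r.
case/andP=> im sm /andP[fi fs]; rewrite Tword_cons -mulrA IH // mulrA.
by rewrite Tword_far // mulrA.
Qed.

(** The elementary case of the two intertwining lemmas for [crossing] below: one
    strand is moved past [q] others. *)
Lemma Tword_iota_shift k q j : (k <= j)%N -> (j.+1 < k + q <= m)%N ->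
  T j.+1 * Tword (iota k q) = Tword (iota k q) * T j.
Proof.
move=> kj jq; have -> : iota k q =
    iota k (j - k) ++ [:: j; j.+1] ++ iota j.+2 (k + q - j.+2).
  have -> : q = ((j - k) + (2 + (k + q - j.+2)))%N by lia.
  rewrite iotaD subnKC //=; congr (_ ++ [:: _, _ & iota _ _]); lia.
rewrite !(Tword_cat, Tword_cons, Tword_nil) mulr1.
rewrite mulrA Tword_far; [|lia|by apply/allP => i; rewrite mem_iota; lia].
rewrite -!mulrA; congr (_ * _); rewrite !mulrA -T_braid ?(leq_trans _ jq) //; last lia.
rewrite -!mulrA; do 2 congr (_ * _).
by apply: Tword_far; [lia|apply/allP => i; rewrite mem_iota; lia].
Qed.

(** Moving two adjacent strands past [q] others commutes with their crossing. *)
Lemma Tword_two_strands k q : (k + q < m)%N ->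
  T k * (Tword (iota k.+1 q) * Tword (iota k q)) =
  Tword (iota k.+1 q) * Tword (iota k q) * T (k + q).
Proof.
elim: q => [|q IH] kq; first by rewrite Tword_nil !mulr1 mul1r addn0.
rewrite -(addn1 q) !iotaD !Tword_cat /= !Tword_cons Tword_nil !mulr1.
have -> : Tword (iota k.+1 q) * T (k.+1 + q) * (Tword (iota k q) * T (k + q)) =
          Tword (iota k.+1 q) * Tword (iota k q) * (T (k + q).+1 * T (k + q)).
  rewrite !mulrA; congr (_ * _); rewrite -!mulrA; congr (_ * _).
  by apply: Tword_far; [lia|apply/allP => i; rewrite mem_iota; lia].
rewrite mulrA IH; last lia.
by rewrite -!mulrA; do 2 congr (_ * _); rewrite addn1 addnS !mulrA T_braid //; lia.
Qed.

(** A reduced word of the permutation moving the [p] strands from position [k]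
    on past the next [q] ones. *)
Fixpoint crossing k p q : seq nat :=
  if p is p'.+1 then iota (k + p') q ++ crossing k p' q else [::].

Lemma crossingS k p q : crossing k p.+1 q = iota (k + p) q ++ crossing k p q.
Proof. by []. Qed.

Lemma crossing_bounds k p q :
  all (fun i => (k <= i) && (i.+1 < k + p + q))%N (crossing k p q).
Proof.
elim: p => [|p IH] //=; rewrite all_cat; apply/andP; split.
  by apply/allP => i; rewrite mem_iota; lia.
by apply: sub_all IH => i /=; lia.
Qed.

Lemma crossing_shift_right k p q i : (k + p + q <= m.+1)%N ->
  (k <= i)%N -> (i.+1 < k + q)%N ->
  T (i + p) * Tword (crossing k p q) = Tword (crossing k p q) * T i.
Proof.
elim: p => [|p IH] km ki iq; first by rewrite Tword_nil addn0 mulr1 mul1r.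
rewrite crossingS Tword_cat mulrA addnS Tword_iota_shift; try lia.
by rewrite -!mulrA IH //; lia.
Qed.

Lemma crossing_shift_left k p q i : (k + p + q <= m.+1)%N ->
  (k <= i)%N -> (i.+1 < k + p)%N ->
  T i * Tword (crossing k p q) = Tword (crossing k p q) * T (i + q).
Proof.
case: q => [|q].
  move=> _ _ _; rewrite addn0; have -> : crossing k p 0 = [::] by elim: p.
  by rewrite Tword_nil mulr1 mul1r.
elim: p => [|p IH] km ki ip; first by lia.
have [ip'|ip'] := ltnP i.+1 (k + p).
  rewrite crossingS Tword_cat mulrA Tword_far; first by rewrite -!mulrA IH //; lia.
    by lia.
  by apply/allP => j; rewrite mem_iota; lia.
case: p IH km ip ip' => [|p] _ km ip ip'; first by lia.
have -> : i = (k + p)%N by lia.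
rewrite !crossingS addnS !Tword_cat !mulrA.
rewrite -(mulrA (T _)) Tword_two_strands; last by lia.
rewrite -!mulrA; do 2 congr (_ * _); apply: Tword_far; first by lia.
by apply: sub_all (crossing_bounds k p q.+1) => j /=; lia.
Qed.

Lemma Tword_intertwine (f h : nat -> nat) (s : seq nat) Y :
  {in s, forall i, T (f i) * Y = Y * T (h i)} ->
  Tword (map f s) * Y = Y * Tword (map h s).
Proof.
elim: s => [|i s IH] sY /=; first by rewrite !Tword_nil mulr1 mul1r.
rewrite !Tword_cons -mulrA IH => [|j js]; last by apply: sY; rewrite inE js orbT.
by rewrite mulrA sY ?inE ?eqxx // mulrA.
Qed.

Variables (V : Type) (t : A -> V).
Hypothesis t_comm : forall x y, t (x * y) = t (y * x).

Lemma trace_block_swap g1 p q g2 : (0 < p)%N -> (0 < q)%N ->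
  sumn (g1 ++ p :: q :: g2) = m.+1 ->
  t (Tword (gamma_word_from 0 (g1 ++ p :: q :: g2))) =
  t (Tword (gamma_word_from 0 (g1 ++ q :: p :: g2))).
Proof.
case: p => // p _; case: q => // q _; rewrite sumn_cat /= => sm.
rewrite !gamma_word_from_cat /= add0n; set k := sumn g1 in sm *.
have -> : (k + q.+1 + p.+1 = k + p.+1 + q.+1)%N by lia.
set W1 := gamma_word_from 0 g1; set W2 := gamma_word_from _ g2.
have b1 := gamma_word_from_bounds 0 g1; rewrite -/W1 add0n -/k in b1.
have b2 := gamma_word_from_bounds (k + p.+1 + q.+1) g2; rewrite -/W2 in b2.
set Y := crossing k p.+1 q.+1.
have bY := crossing_bounds k p.+1 q.+1; rewrite -/Y in bY.
have Ym : all (fun i => i < m)%N Y by apply: sub_all bY => i /=; lia.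
have [Y' [YY' Y'Y]] := Tword_inv Ym.
have W1Y : Tword W1 * Tword Y = Tword Y * Tword W1.
  apply: Tword_far_word; first by apply: sub_all b1 => i /=; lia.
  by apply: sub_all b1 => i /= ik; apply: sub_all bY => j /=; lia.
have W2Y : Tword W2 * Tword Y = Tword Y * Tword W2.
  apply: Tword_far_word; first by apply: sub_all b2 => i /=; lia.
  by apply: sub_all b2 => i /= ik; apply: sub_all bY => j /=; lia.
have pY : Tword (iota k p) * Tword Y = Tword Y * Tword (iota (k + q.+1) p).
  rewrite -[iota k p]map_id addnC iotaDl.
  apply: Tword_intertwine => i; rewrite mem_iota => ik.
  by rewrite (addnC _ i); apply: crossing_shift_left; lia.
have qY : Tword (iota (k + p.+1) q) * Tword Y = Tword Y * Tword (iota k q).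
  rewrite (addnC k) iotaDl -[in RHS](map_id (iota k q)).
  apply: Tword_intertwine => i; rewrite mem_iota => ik.
  by rewrite addnC; apply: crossing_shift_right; lia.
rewrite !Tword_cat.
have pq : Tword (iota k q) * Tword (iota (k + q.+1) p) =
          Tword (iota (k + q.+1) p) * Tword (iota k q).
  apply: Tword_far_word; first by apply/allP => i; rewrite mem_iota; lia.
  by apply/allP => i; rewrite mem_iota => ik; apply/allP => j; rewrite mem_iota; lia.
have -> : Tword W1 * (Tword (iota k p) * (Tword (iota (k + p.+1) q) * Tword W2)) =
  Tword Y * (Tword W1 * (Tword (iota k q) * Tword (iota (k + q.+1) p)) *
             (Tword W2 * Y')).
  rewrite pq -!mulrA (mulrA (Tword Y)) -W1Y -!mulrA; congr (_ * _).
  rewrite (mulrA (Tword Y)) -pY -!mulrA; congr (_ * _).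
  rewrite (mulrA (Tword Y)) -qY -!mulrA; congr (_ * _).
  by rewrite (mulrA (Tword Y)) -W2Y -mulrA YY' mulr1.
rewrite t_comm -!mulrA Y'Y mulr1.
by [].
Qed.

(** Conjugating by the positive braid that crosses two neighbouring blocks
    shows that a trace does not see the order of the blocks. *)
Lemma trace_gamma_perm g1 g2 : all (leq 1) g1 -> sumn g1 = m.+1 ->
  perm_eq g2 g1 ->
  t (Tword (gamma_word_from 0 g2)) = t (Tword (gamma_word_from 0 g1)).
Proof.
move=> g1pos g1m; apply: (adjacent_swap_perm
  (f := fun g => t (Tword (gamma_word_from 0 g)))) => x a b y pxy.
have := perm_all (leq 1) pxy; rewrite g1pos all_cat /= => /and4P[_ a0 b0 _].
by apply: trace_block_swap => //; rewrite -g1m; exact: perm_sumn.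
Qed.

End BlockSwap.

(** * Hecke generators inside the super tensor product *)

Section HeckeClifford.
Variables (K : fieldType) (v : K) (m : nat).
Hypothesis v0 : v != 0.
Local Notation T := (hcT v).
Local Notation c := (@hcC K v m).
Implicit Types (i j : 'I_m) (k l : 'I_m.+1).

Let rel s t : hecke_clifford_rel v s t ->
  pcls (P := hecke_clifford v m) s = pcls (P := hecke_clifford v m) t.
Proof. exact: (@palg_relP _ (hecke_clifford v m)). Qed.

Let pclsE := (pcls_scale, pclsD, pclsM, pclsC).

Local Notation one := (1 : palg (hecke_clifford v m)).

Lemma hcT_quad i : T i * T i = (v - 1) *: T i + v *: one.
Proof.
have := rel (HCquad v i); rewrite !pclsE -/(hcT v i) scale0r => /eqP.
rewrite !(mulrDl, mulrDr) -!palg_scaleAl -!palg_scaleAr !mul1r !scale1r !mulr1.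
rewrite !scaleN1r addrACA addrA => E; apply/eqP; rewrite -subr_eq0.
rewrite -(eqP E) scalerBl scale1r; apply/eqP.
by rewrite !opprD opprK !addrA.
Qed.

Lemma hcT_far i j : far i j -> T i * T j = T j * T i.
Proof. by move=> fij; have := rel (HCfar v fij); rewrite !pclsM. Qed.

Lemma hcT_braid i j : j = i.+1 :> nat -> T i * T j * T i = T j * T i * T j.
Proof. by move=> ji; have := rel (HCbraid v ji); rewrite !pclsM. Qed.

Lemma hcC_sq k : c k * c k = 1.
Proof. by have := rel (HCsq v k); rewrite !pclsE scale1r. Qed.

Lemma hcT_comm i k : k != ix0 i -> k != ix1 i -> T i * c k = c k * T i.
Proof. by move=> k0 k1; have := rel (HCcomm v k0 k1); rewrite !pclsM. Qed.

Lemma hcC_anti k l : k != l -> c k * c l = - (c l * c k).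
Proof. by move=> kl; have := rel (HCanti v kl); rewrite !pclsE scaleN1r. Qed.

Lemma hcT_move i : T i * c (ix0 i) = c (ix1 i) * T i.
Proof. by have := rel (HCmove v i); rewrite !pclsM. Qed.

Lemma hcT_inv i : exists T', T i * T' = 1 /\ T' * T i = 1.
Proof.
exists (v^-1 *: (T i - (v - 1) *: one)).
rewrite -palg_scaleAr -palg_scaleAl mulrBl mulrBr hcT_quad.
rewrite -palg_scaleAr -palg_scaleAl mul1r mulr1 addrAC addrN add0r.
by rewrite scalerA mulVf // scale1r.
Qed.

(** Multiply on the right by the invertible element [T_i] and use
    [T_i c_i = c_(i+1) T_i] twice. *)
Lemma hcT_move_back i : T i * c (ix1 i) =
  c (ix0 i) * T i + (v - 1) *: (c (ix1 i) - c (ix0 i)).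
Proof.
have [T' [TT' _]] := hcT_inv i.
suff E : (T i * c (ix1 i) - (c (ix0 i) * T i +
            (v - 1) *: (c (ix1 i) - c (ix0 i)))) * T i = 0.
  by apply/eqP; rewrite -subr_eq0 -[X in X == _]mulr1 -TT' mulrA E mul0r.
rewrite mulrBl -mulrA -hcT_move mulrA hcT_quad !mulrDl -!mulrA hcT_quad.
rewrite mulrDr -!(palg_scaleAl, palg_scaleAr) mul1r mulr1 hcT_move mulrBl scalerBr.
by rewrite [X in _ - X]addrC addrA subrK addrN.
Qed.

End HeckeClifford.

Section SuperTensorProduct.
Variables (K : fieldType) (v : K) (m : nat).
Hypotheses (v0 : v != 0) (two0 : 2%:R != 0 :> K).
Local Notation H := (palg (spin_hecke v m)).
Local Notation C := (palg (clifford K m)).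
Local Notation S := (palg (stensor (spin_hecke v m) (clifford K m))).
Local Notation one := (1 : S).
Implicit Types (i j : 'I_m) (k l : 'I_m.+1) (u w : seq 'I_m).

Let relS s t : stensor_rel s t ->
  pcls (P := stensor (spin_hecke v m) (clifford K m)) s =
  pcls (P := stensor (spin_hecke v m) (clifford K m)) t.
Proof. exact: (@palg_relP _ (stensor (spin_hecke v m) (clifford K m))). Qed.

Definition emb_l (h : H) : S := pelt (P := stensor _ _) (inl h).
Definition emb_r (h : C) : S := pelt (P := stensor _ _) (inr h).

Lemma emb_lD : {morph emb_l : x y / x + y}.
Proof. by move=> x y; have := relS (SLD _ x y); rewrite pclsD. Qed.

Lemma emb_lM : {morph emb_l : x y / x * y}.
Proof. by move=> x y; have := relS (SLM _ x y); rewrite pclsM. Qed.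

Lemma emb_lZ a x : emb_l (a *: x) = a *: emb_l x.
Proof. by have := relS (SLZ _ a x); rewrite pcls_scale. Qed.

Lemma emb_l1 : emb_l 1 = 1.
Proof. by have := relS (SL1 _ _); rewrite pclsC scale1r. Qed.

Lemma emb_rM : {morph emb_r : x y / x * y}.
Proof. by move=> x y; have := relS (SRM _ x y); rewrite pclsM. Qed.

Lemma emb_rZ a x : emb_r (a *: x) = a *: emb_r x.
Proof. by have := relS (SRZ _ a x); rewrite pcls_scale. Qed.

Lemma emb_r1 : emb_r 1 = 1.
Proof. by have := relS (SR1 _ _); rewrite pclsC scale1r. Qed.

Lemma pure_tensor_l h : pure_tensor h 1 = emb_l h.
Proof. by rewrite /pure_tensor -/(emb_r 1) emb_r1 mulr1. Qed.

Lemma pure_tensor_r x : pure_tensor 1 x = emb_r x.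
Proof. by rewrite /pure_tensor -/(emb_l 1) emb_l1 mul1r. Qed.

Definition stR i : S := emb_l (shR v i).
Definition stC k : S := emb_r (clC K k).

(** The preimage of [T_i] under [Psi], written out ([PsiT]). *)
Definition stT i : S := 2^-1 *:
  ((- stR i + (v - 1) *: stC (ix0 i)) * (stC (ix0 i) - stC (ix1 i))).

Lemma stC_sq k : stC k * stC k = 1.
Proof.
have := @palg_relP _ (clifford K m) _ _ (Csq K k); rewrite pclsM pclsC scale1r => E.
by rewrite /stC -emb_rM [_ * _]E emb_r1.
Qed.

Lemma stC_anti k l : k != l -> stC k * stC l = - (stC l * stC k).
Proof.
move=> kl; have := @palg_relP _ (clifford K m) _ _ (Canti K kl).
rewrite pcls_scale !pclsM => E.
by rewrite /stC -!emb_rM [_ * _]E emb_rZ scaleN1r.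
Qed.

Lemma stR_odd i : homog true (stR i).
Proof. by apply: HomogGen => /=; apply: HomogGen. Qed.

Lemma stC_odd k : homog true (stC k).
Proof. by apply: HomogGen => /=; apply: HomogGen. Qed.

Lemma stRC i k : stR i * stC k = - (stC k * stR i).
Proof.
have hR : homog true (shR v i) by apply: HomogGen.
have hC : homog true (clC K k) by apply: HomogGen.
have := relS (SSuper hR hC); rewrite pcls_scale !pclsM expr1 scaleN1r => E.
by rewrite [stC k * _]E opprK.
Qed.

Lemma stT_even i : homog false (stT i).
Proof.
have homogN b (x : S) : homog b x -> homog b (- x).
  by rewrite -scaleN1r; exact: HomogZ.
apply/HomogZ/(@HomogM _ _ true true); apply: HomogD; first exact/homogN/stR_odd.
- by apply/HomogZ/stC_odd.
- exact: stC_odd.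
- exact/homogN/stC_odd.
Qed.

Section Isomorphism.
Variable Psi : {rmorphism S -> palg (hecke_clifford v m)}.
Hypothesis PsiP : Psi_spec Psi.

Let PsiZ a x : Psi (a *: x) = a *: Psi x.
Proof. by have [Z _ _ _ _] := PsiP; exact: Z. Qed.

Let Psi_inj : injective Psi.
Proof. by have [_ B _ _ _] := PsiP; exact: bij_inj. Qed.

Let PsiR i : Psi (stR i) =
  (hcC v (ix0 i) - hcC v (ix1 i)) * hcT v i + (v - 1) *: hcC v (ix1 i).
Proof. by have [_ _ _ + _] := PsiP => /(_ i); rewrite pure_tensor_l. Qed.

Let PsiC k : Psi (stC k) = hcC v k.
Proof. by have [_ _ _ _ +] := PsiP => /(_ k); rewrite pure_tensor_r. Qed.

Lemma PsiT i : Psi (stT i) = hcT v i.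
Proof.
rewrite PsiZ rmorphM rmorphD rmorphN rmorphB PsiR PsiZ !PsiC.
have ne : ix0 i != ix1 i by rewrite -val_eqE /= /bump; lia.
set a := hcC v (ix0 i); set b := hcC v (ix1 i); set X := hcT v i; set q := v - 1.
have Xab : X * (a - b) = - ((a - b) * X) + q *: (a - b).
  rewrite mulrBr hcT_move hcT_move_back // -/a -/b -/X -/q mulrBl opprB.
  by rewrite opprD addrA -scalerN opprB.
have sq : (a - b) * (a - b) = 1 + 1.
  rewrite mulrBr !mulrBl !hcC_sq (hcC_anti v ne : a * b = - (b * a)).
  by rewrite -/a -/b opprB opprK addrACA addNr addr0.
have -> : - ((a - b) * X + q *: b) + q *: a = - ((a - b) * X) + q *: (a - b).
  by rewrite opprD -addrA scalerBr [q *: a - _]addrC.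
rewrite mulrDl mulNr -mulrA Xab mulrDr mulrN opprD opprK mulrA -palg_scaleAl.
rewrite -palg_scaleAr subrK sq mulrDl mul1r -mulr2n.
by rewrite -(@scaler_nat K) scalerA mulVf // scale1r.
Qed.

Lemma stT_far i j : far i j -> stT i * stT j = stT j * stT i.
Proof. by move=> fij; apply: Psi_inj; rewrite !rmorphM !PsiT hcT_far. Qed.

Lemma stT_braid i j : j = i.+1 :> nat ->
  stT i * stT j * stT i = stT j * stT i * stT j.
Proof. by move=> ji; apply: Psi_inj; rewrite !rmorphM !PsiT (hcT_braid v ji). Qed.

Lemma stT_comm i k : k != ix0 i -> k != ix1 i -> stT i * stC k = stC k * stT i.
Proof.
by move=> k0 k1; apply: Psi_inj; rewrite !rmorphM PsiT PsiC hcT_comm.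
Qed.

Lemma stT_inv i : exists T', stT i * T' = 1 /\ T' * stT i = 1.
Proof.
have [_ [Phi PhiK PsiK] _ _ _] := PsiP; have [T' [TT' T'T]] := hcT_inv v0 i.
by exists (Phi T'); split; apply: Psi_inj; rewrite rmorphM PsiT PsiK rmorph1.
Qed.

Lemma Psi_stT_word u : Psi (\prod_(i <- u) stT i) = hcT_word v u.
Proof. by rewrite rmorph_prod; apply: eq_bigr => i _; exact: PsiT. Qed.

End Isomorphism.
End SuperTensorProduct.

(** * Traces on the spin Hecke algebra *)

Section Paired.
Variable m : nat.
Implicit Types (u w : seq 'I_m) (i j : 'I_m).

Lemma incr_cat u w : incr (u ++ w) =
  [&& incr u, incr w & all (fun i => all (fun j => i < j)%N w) u].
Proof.
rewrite /incr map_cat !(sorted_pairwise ltn_trans) pairwise_cat.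
rewrite andbC -andbA /allrel all_map; congr [&& _, _ & _].
by apply: eq_all => i /=; rewrite all_map.
Qed.

Lemma incr_cons i u : incr (i :: u) = incr u && all (fun j => i < j)%N u.
Proof. by rewrite -cat1s incr_cat /= andbT. Qed.

(** For an increasing word [paired] says that every block has evenly many
    letters, that is, that every part of the composition is odd. *)
Fixpoint paired u : bool :=
  match u with
  | [::] => true
  | i :: u' => if u' is j :: u'' then (val j == i.+1) && paired u'' else false
  end.

Lemma pair_ind (P : seq 'I_m -> Prop) :
  P [::] -> (forall i, P [:: i]) ->
  (forall i j u, P u -> P (i :: j :: u)) -> forall u, P u.
Proof.
move=> P0 P1 P2 u; suff [] : P u /\ forall i, P (i :: u) by [].
by elim: u => [|i u [Pu Piu]]; split=> // j; apply: P2.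
Qed.

Lemma unpaired_split u : incr u -> ~~ paired u -> odd (size u) \/
  exists p q, [/\ u = p ++ q, odd (size p) &
    all (fun i => all (fun j => i.+1 < j)%N q) p].
Proof.
elim/pair_ind: u => [|i|i j u IH] //; first by left.
rewrite !incr_cons /= => /andP[/andP[iu ju] /andP[ij _]].
have [ji|ji] := eqVneq (j : nat) i.+1 => /=; last first.
  move=> _; right; exists [:: i], (j :: u); split=> //=; rewrite andbT.
  by apply/andP; split; [lia|apply: sub_all ju => k; lia].
case/(IH iu) => [od|[p [q [Eu op pq]]]]; first by left; rewrite /= negbK.
right; exists (i :: j :: p), q; rewrite Eu /= negbK; split=> //.
rewrite pq andbT; case: p op pq Eu => // k p _ /andP[kq _] Eu.
move: ju; rewrite Eu all_cat /= => /andP[/andP[jk _] _].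
by apply/andP; split; apply: sub_all kq => l /=; lia.
Qed.

End Paired.

Section SpinTrace.
Variables (K : fieldType) (v : K) (m : nat).
Hypothesis two0 : 2%:R != 0 :> K.
Variables (tau : palg (spin_hecke v m) -> K) (tr_tau : trace_function tau).
Implicit Types (u w x y : seq 'I_m) (i j : 'I_m).
Local Notation R := (shR_word v).

Lemma shR_cat u w : R (u ++ w) = R u * R w.
Proof. exact: big_cat. Qed.

Lemma shR_cons i u : R (i :: u) = shR v i * R u.
Proof. exact: big_cons. Qed.

Lemma shR_nil : R [::] = 1 :> palg (spin_hecke v m).
Proof. exact: big_nil. Qed.

Let rel s t : spin_hecke_rel v s t ->
  pcls (P := spin_hecke v m) s = pcls (P := spin_hecke v m) t.
Proof. exact: (@palg_relP _ (spin_hecke v m)). Qed.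

Lemma shR_sq i : shR v i * shR v i = - (v ^+ 2 + 1) *: (1 : palg _).
Proof. by have := rel (SHquad v i); rewrite pclsM pclsC. Qed.

Lemma shR_far i j : far i j -> shR v i * shR v j = - (shR v j * shR v i).
Proof.
by move=> fij; have := rel (SHfar v fij); rewrite pcls_scale !pclsM scaleN1r.
Qed.

Lemma shR_braid i j : j = i.+1 :> nat ->
  shR v i * shR v j * shR v i =
  shR v j * shR v i * shR v j + (v - 1) ^+ 2 *: (shR v j - shR v i).
Proof.
move=> ji; have := rel (SHbraid v ji); rewrite !(pcls_scale, pclsD, pclsM).
by rewrite !scaleN1r => /eqP; rewrite subr_eq addrC => /eqP.
Qed.

Lemma shR_homog u : homog (odd (size u)) (R u).
Proof.
elim: u => [|i u IH]; first by rewrite shR_nil; exact: Homog1.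
rewrite shR_cons -[odd _]/(true (+) odd (size u)).
by apply: HomogM => //; exact: HomogGen.
Qed.

Lemma shR_far_cat u w : all (fun i => all (far i) w) u ->
  R u * R w = (-1) ^+ (odd (size u) && odd (size w)) * (R w * R u).
Proof.
move=> uw; rewrite -oddM signr_odd.
elim: u uw => [_|i u IH /= /andP[iw uw]]; first by rewrite shR_nil !(mul1r, mulr1).
have -> : R (i :: u) * R w = shR v i * R w * ((-1) ^+ (size u * size w)%N * R u).
  rewrite shR_cons -mulrA IH // -!mulrA; congr (_ * _).
  by rewrite !mulrA (commr_sign (R w)).
have -> : shR v i * R w = (-1) ^+ size w * (R w * shR v i).
  elim: w iw {uw IH} => [|j w IH /= /andP[ij iw]].
    by rewrite shR_nil !(mul1r, mulr1).
  rewrite shR_cons mulrA shR_far // mulNr -(mulrA (shR v j) (shR v i)) IH //.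
  rewrite exprS mulN1r mulNr.
  by rewrite !mulrA (commr_sign (shR v j)).
rewrite mulSn exprD shR_cons -!mulrA; congr (_ * _).
by rewrite !mulrA (commr_sign (R w * shR v i)) ?mulrA // -mulrA.
Qed.

(** In an unpaired word of even length, the part up to the end of the first block
    with oddly many letters is odd, and so is the rest; being far apart the two
    anticommute, whereas a trace does not distinguish their two products. *)
Lemma trace_unpaired u : incr u -> ~~ paired u -> tau (R u) = 0.
Proof.
move=> iu npu; have [ou|eu] := boolP (odd (size u)).
  by apply: (trace_odd tr_tau); have := shR_homog u; rewrite ou.
have [ou|[p [q [Eu op pq]]]] := unpaired_split iu npu; first by rewrite ou in eu.
have oq : odd (size q) by move: eu; rewrite Eu size_cat oddD op /= negbK.
have fpq : all (fun i => all (far i) q) p.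
  by apply: sub_all pq => i /=; apply: sub_all => j; rewrite /far => ->.
have : tau (R u) = - tau (R u).
  rewrite {1}Eu shR_cat shR_far_cat // op oq expr1 mulN1r (traceN tr_tau).
  by rewrite (trace_comm tr_tau) -shR_cat -Eu.
move/eqP; rewrite -subr_eq0 opprK -mulr2n -mulr_natl mulf_eq0 (negPf two0).
by move/eqP.
Qed.

(** On words without repeated letters the squares and the braid moves never
    apply, so the reduction to an increasing word only costs a sign. *)
Lemma trace_uniq :
  (forall u, incr u -> u != [::] -> tau (R u) = 0) ->
  forall u, uniq u -> u != [::] -> tau (R u) = 0.
Proof.
move=> incr0 u.
apply: (@word_ind _ (fun u => uniq u -> u != [::] -> tau (R u) = 0)) => {u}.
- by move=> x i y _; rewrite !cat_uniq /= inE eqxx !andbF.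
- move=> x i j y fij IH un _.
  rewrite !shR_cat !shR_cons shR_nil mulr1 shR_far // mulNr mulrN (traceN tr_tau).
  have := IH; rewrite !shR_cat !shR_cons shR_nil mulr1 => ->; rewrite ?oppr0 //.
    rewrite (@perm_uniq _ _ (x ++ [:: i; j] ++ y)) //.
    by rewrite perm_cat2l perm_cat2r (perm_catC [:: j] [:: i]).
  by case: (x).
- by move=> x i j y _ _ _ _; rewrite !cat_uniq /= !inE eqxx orbT !andbF.
- move=> x y IH un ne; rewrite shR_cat (trace_comm tr_tau) -shR_cat.
  by apply: IH; [rewrite uniq_catC|case: (x) (y) ne => [|? ?] []].
- by move=> u iu _; exact: incr0.
Qed.

(** Modulo commutators the spin Hecke algebra is spanned by the products along
    strictly increasing words. *)
Lemma trace_eq0 : (forall u, incr u -> tau (R u) = 0) -> forall h, tau h = 0.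
Proof.
move=> incr0.
have words0 u : tau (R u) = 0.
  apply: (@word_ind _ (fun u => tau (R u) = 0)) => {u} //.
  - move=> x i y IH; rewrite !shR_cat !shR_cons shR_nil mulr1 shR_sq.
    by rewrite -palg_scaleAl mul1r -palg_scaleAr (traceZ tr_tau) -shR_cat IH mulr0.
  - move=> x i j y fij; rewrite !shR_cat !shR_cons shR_nil !mulr1 (shR_far fij).
    by rewrite mulNr mulrN (traceN tr_tau) => ->; rewrite oppr0.
  - move=> x i j y ji; rewrite !shR_cat !shR_cons shR_nil !mulr1 => E1 E2 E3.
    rewrite [X in R x * (X * _)]mulrA shR_braid // mulrDl mulrDr (traceD tr_tau).
    rewrite -(mulrA (shR v j) (shR v i)) E1 add0r.
    rewrite -palg_scaleAl -palg_scaleAr (traceZ tr_tau).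
    by rewrite mulrBl mulrBr (traceD tr_tau) (traceN tr_tau) E2 E3 subrr mulr0.
  - by move=> x y; rewrite !shR_cat (trace_comm tr_tau).
(* Linear functionals rather than traces, so that the product case can fix
   one factor. *)
suff gen (h : palg (spin_hecke v m)) : forall f : palg (spin_hecke v m) -> K,
    {morph f : a b / a + b} ->
    (forall b (a : palg (spin_hecke v m)), f (b *: a) = b * f a) ->
    (forall u, f (R u) = 0) -> f h = 0.
  by move=> h; apply: gen words0; [exact: (traceD tr_tau)|exact: (traceZ tr_tau)].
elim/palg_ind: h => [i|a|x y fx fy|x y fx fy] f fD fZ f0.
- by have := f0 [:: i]; rewrite shR_cons shR_nil mulr1.
- by rewrite fZ -shR_nil f0 mulr0.
- by rewrite fD fx // fy // addr0.
- apply: (fx (fun z => f (z * y))) => [z z'|a z|u]; rewrite ?mulrDl ?fD //.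
    by rewrite -palg_scaleAl fZ.
  apply: (fy (fun z => f (R u * z))) => [z z'|a z|w]; rewrite ?mulrDr ?fD //.
    by rewrite -palg_scaleAr fZ.
  by rewrite -shR_cat f0.
Qed.

End SpinTrace.

(** * Expanding a trace along the Hecke generators *)

Section GammaWords.
Variable m : nat.
Implicit Types (u w : seq 'I_m) (i j : 'I_m).

Lemma sorted_gamma_word_from a g : sorted ltn (gamma_word_from a g).
Proof.
elim: g a => [|g gs IH] a //=.
rewrite (sorted_pairwise ltn_trans) pairwise_cat -!(sorted_pairwise ltn_trans).
rewrite iota_ltn_sorted IH !andbT; apply/allrelP => i j.
rewrite mem_iota => ia /(allP (gamma_word_from_bounds _ _)) /=; lia.
Qed.

Lemma gamma_wordE g : sumn g = m.+1 ->
  map val (gamma_word m g) = gamma_word_from 0 g.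
Proof.
move=> gm; rewrite /gamma_word (pmap_filter (insubK _)); apply/all_filterP.
apply: sub_all (gamma_word_from_bounds 0 g) => i /=.
by rewrite isSome_insub; lia.
Qed.

Lemma incr_gamma_word g : sumn g = m.+1 -> incr (gamma_word m g).
Proof. by move=> gm; rewrite /incr gamma_wordE // sorted_gamma_word_from. Qed.

Lemma size_gamma_word_from a g : all (leq 1) g ->
  (size (gamma_word_from a g) + size g = sumn g)%N.
Proof.
elim: g a => [|g gs IH] a //= /andP[g0 gs0].
by rewrite size_cat size_iota -(IH (a + g)%N gs0); lia.
Qed.

Lemma size_gamma_word g : all odd g -> sumn g = m.+1 ->
  size (gamma_word m g) = (m.+1 - size g)%N.
Proof.
move=> og gm; rewrite -(size_map val) gamma_wordE // -gm.
rewrite -(@size_gamma_word_from 0) ?addnK //.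
by apply: sub_all og => i; case: i.
Qed.

(** Read from position [a] on, the word either skips [a], which gives a part [1],
    or starts with the pair [a], [a + 1], which adds [2] to the first part of
    the composition of the remaining word from [a + 2] on. *)
Lemma paired_gamma_word u : incr u -> paired u ->
  exists g, [/\ all odd g, sumn g = m.+1 & gamma_word_from 0 g = map val u].
Proof.
suff gen d a : (a + d.+1 = m.+1)%N -> forall u, incr u -> paired u ->
    all (fun i => a <= i)%N u ->
    exists g, [/\ all odd g, sumn g = d.+1 & gamma_word_from a g = map val u].
  by move=> iu pu; apply: (@gen m 0%N) => //; apply/allP.
have [n] := ubnP d; elim: n d a => // n IH d a dn ad {}u iu pu ua.
have next a' d' u' : (d' < d)%N -> (a' + d'.+1 = m.+1)%N -> incr u' -> paired u' ->
    all (fun i => a' <= i)%N u' ->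
    exists g, [/\ all odd g, sumn g = d'.+1 & gamma_word_from a' g = map val u'].
  by move=> dd ad' iu' pu' ua'; apply: (IH d' a') => //; lia.
have [hd|hd] := boolP (all (fun i => a < i)%N u).
  case: d dn ad next => [|d] dn ad next.
    exists [:: 1%N]; split=> //=; case: u hd {iu pu ua} => //= i u /andP[ai _].
    by have := ltn_ord i; lia.
  have [g [og sg Eg]] := next a.+1 d u (ltnSn d) (etrans (addSnnS _ _) ad) iu pu hd.
  by exists (1%N :: g); rewrite /= og sg addn1 Eg add1n.
case: u iu pu ua hd => [|i [|j u]] //.
rewrite !incr_cons /= => /andP[/andP[iu ju] /andP[ij iu']] /andP[/eqP ji pu].
case/and3P=> ai aj au hd.
have ia : i = a :> nat.
  apply/eqP; rewrite eqn_leq ai andbT leqNgt; apply: contra hd => ai'.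
  by rewrite ai' (ltn_trans ai' ij); apply: sub_all iu' => k /=; lia.
case: d dn ad next => [|[|d]] dn ad next; try by have := ltn_ord j; lia.
have [g [og sg Eg]] : exists g, [/\ all odd g, sumn g = d.+1
    & gamma_word_from a.+2 g = map val u].
  by apply: next => //; [lia|apply: sub_all ju => k /=; lia].
case: g og sg Eg => [|[|b] g] //= /andP[ob og] sg Eg.
exists (b.+3 :: g); rewrite /= negbK ob og -Eg ji ia; split=> //; first by lia.
by rewrite !addSn !addnS.
Qed.

End GammaWords.

Section Expansion.
Variables (K : fieldType) (v : K) (m : nat).
Hypotheses (v0 : v != 0) (two0 : 2%:R != 0 :> K).
Local Notation S := (palg (stensor (spin_hecke v m) (clifford K m))).
Variable Psi : {rmorphism S -> palg (hecke_clifford v m)}.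
Hypothesis PsiP : Psi_spec Psi.
Variables (t : S -> K) (tr_t : trace_function t).
Implicit Types (u w : seq 'I_m) (i j : 'I_m) (k : 'I_m.+1).
Local Notation r := (@stR K v m).
Local Notation c := (@stC K v m).
Local Notation T := (@stT K v m).
Local Notation delta := ((v - 1) / 2).

Let RW w : S := emb_l (shR_word v w).
Let TW u : S := \prod_(i <- u) T i.
Let phi w := t (RW w).

Let RW_rcons w i : RW (rcons w i) = RW w * r i.
Proof. by rewrite /RW /stR -emb_lM -cats1 shR_cat shR_cons shR_nil mulr1. Qed.

Let RW_homog w : homog (odd (size w)) (RW w).
Proof. by apply: HomogGen => /=; exact: shR_homog. Qed.

Let RWC w k : RW w * c k = (-1) ^+ size w * (c k * RW w).
Proof.
elim/last_ind: w => [|w i IH].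
  by rewrite /RW shR_nil emb_l1 !(mul1r, mulr1).
rewrite RW_rcons -mulrA stRC mulrN (mulrA (RW w)) IH size_rcons exprS mulN1r mulNr.
by rewrite !mulrA.
Qed.

(* A product [Y c_k X] in which [c_k] commutes with [X]: either the product is
   odd, or moving [c_k] once around it changes the sign. *)
Let once k X Y : c k * X = X * c k -> homog false X ->
  homog false Y \/ Y * c k = - (c k * Y) -> t (Y * (c k * X)) = 0.
Proof.
move=> cX hX [hY|Yc].
  apply: (trace_odd tr_t); apply: (@HomogM _ _ false true) => //.
  by apply: (@HomogM _ _ true false) => //; exact: stC_odd.
have : t (Y * (c k * X)) = - t (Y * (c k * X)).
  rewrite {1}cX mulrA (trace_comm tr_t) mulrA -[c k * Y]opprK -Yc mulNr.
  by rewrite (traceN tr_t) mulrA.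
move/eqP; rewrite -subr_eq0 opprK -mulr2n -mulr_natl mulf_eq0 (negPf two0).
by move/eqP.
Qed.

Let RW_once w k : homog false (RW w) \/ RW w * c k = - (c k * RW w).
Proof.
case: (boolP (odd (size w))) (RW_homog w) => ow hw; [right|by left].
by rewrite RWC -signr_odd ow expr1 mulN1r.
Qed.

Let RWC_once w k l : k != l -> homog false (RW w * c l) \/
  RW w * c l * c k = - (c k * (RW w * c l)).
Proof.
move=> kl; case: (boolP (odd (size w))) (RW_homog w) => ow hw.
  by left; apply: (@HomogM _ _ true true) => //; exact: stC_odd.
right; rewrite -mulrA (stC_anti v (_ : l != k)) 1?eq_sym // mulrN (mulrA (RW w)) RWC.
by rewrite -signr_odd (negPf ow) expr0 mul1r mulrA.
Qed.

Let ix01 i : ix0 i != ix1 i.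
Proof. by rewrite -val_eqE /= /bump; lia. Qed.

Let T_mul i X : T i * X =
  2^-1 *: (r i * (c (ix1 i) * X)) - 2^-1 *: (r i * (c (ix0 i) * X)) +
  delta *: X - delta *: (c (ix0 i) * (c (ix1 i) * X)).
Proof.
rewrite /stT -palg_scaleAl.
have -> : (- r i + (v - 1) *: c (ix0 i)) * (c (ix0 i) - c (ix1 i)) =
    r i * c (ix1 i) - r i * c (ix0 i) + (v - 1) *: (1 : S)
    - (v - 1) *: (c (ix0 i) * c (ix1 i)).
  rewrite mulrDl [- r i * _]mulrBr !mulNr opprK [- _ + _]addrC -palg_scaleAl.
  by rewrite [c _ * (_ - _)]mulrBr stC_sq scalerBr addrA.
rewrite !(mulrDl, mulNr) -!palg_scaleAl mul1r -!mulrA.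
by rewrite !(scalerDr, scalerN, scalerA) ![2^-1 * (v - 1)]mulrC ?mulrBl.
Qed.

(** Of the four terms of [T_i], those where [c_i] survives are killed: nothing to
    the right of them involves [c_i]. *)
Lemma expand_T w i X : c (ix0 i) * X = X * c (ix0 i) -> homog false X ->
  t (RW w * (T i * X)) =
  2^-1 * t (RW (rcons w i) * (c (ix1 i) * X)) + delta * t (RW w * X).
Proof.
move=> cX hX; rewrite T_mul !(mulrDr, mulrN) -!palg_scaleAr.
rewrite !(traceD tr_t, traceN tr_t, traceZ tr_t) !RW_rcons -!mulrA.
rewrite [RW w * (r i * (c (ix0 i) * X))]mulrA -RW_rcons (once cX) //.
rewrite mulr0 subr0.
rewrite [c (ix0 i) * (c (ix1 i) * X)]mulrA (stC_anti v (ix01 i)) mulNr mulrN -mulrA.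
rewrite (traceN tr_t) [RW w * (c (ix1 i) * _)]mulrA (once cX) ?oppr0 ?mulr0 ?subr0 //.
exact: RWC_once.
Qed.

(** With a [c_i] already present, the surviving terms are the other two. *)
Lemma expand_cT w i X : c (ix0 i) * X = X * c (ix0 i) -> homog false X ->
  t (RW w * (c (ix0 i) * (T i * X))) =
  2^-1 * t (RW (rcons w i) * X) - delta * t (RW w * (c (ix1 i) * X)).
Proof.
move=> cX hX; rewrite T_mul !(mulrDr, mulrN) -!palg_scaleAr.
have cr : c (ix0 i) * r i = - (r i * c (ix0 i)) by rewrite stRC opprK.
have E1 Y : c (ix0 i) * (r i * Y) = - (r i * (c (ix0 i) * Y)).
  by rewrite mulrA cr mulNr -mulrA.
have cc Y : c (ix0 i) * (c (ix0 i) * Y) = Y by rewrite mulrA stC_sq mul1r.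
rewrite !E1 !cc [c (ix0 i) * (c (ix1 i) * X)]mulrA (stC_anti v (ix01 i)) mulNr.
rewrite -(mulrA (c (ix1 i))).
rewrite !mulrN !opprK !(traceD tr_t, traceN tr_t, traceZ tr_t).
rewrite (once cX) //.
have -> : RW w * (r i * (c (ix1 i) * (c (ix0 i) * X))) =
          RW (rcons w i) * c (ix1 i) * (c (ix0 i) * X).
  by rewrite RW_rcons -!mulrA.
rewrite (once cX) //; last exact: RWC_once.
by rewrite RW_rcons -!(mulrA (RW w)) !(mulr0, mulrN, opprK, add0r, addr0).
Qed.

(** The coefficient of [t(R_(w u))] in [t(R_w T_u)] for [k = None], and in
    [t(R_w c_k' T_u)] for [k = Some k']. *)
Fixpoint leading (k : option nat) u : K :=
  match u with
  | [::] => (k == None)%:R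
  | i :: u' =>
    if k is Some k' then (k' == i)%:R / 2 * leading None u'
    else 2^-1 * leading (Some i.+1) u'
  end.

Lemma leading_neq0 u : paired u -> leading None u != 0.
Proof.
elim/pair_ind: u => [|i|i j u IH] //=; first by rewrite oner_neq0.
case/andP=> /eqP -> /IH u0; rewrite eqxx mul1r !mulf_neq0 // invr_neq0 //.
Qed.

Lemma TW_comm u k : all (fun i => k < i)%N u -> c k * TW u = TW u * c k.
Proof.
elim: u => [|i u IH] /=; first by rewrite /TW big_nil mulr1 mul1r.
case/andP=> ki ku; rewrite /TW big_cons mulrA.
rewrite -(stT_comm v0 two0 PsiP); first by rewrite -mulrA IH // mulrA.
  by rewrite -val_eqE /=; lia.
by rewrite -val_eqE /= /bump; lia.
Qed.

Lemma TW_homog u : homog false (TW u).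
Proof.
rewrite /TW; elim: u => [|i u IH]; first by rewrite big_nil; exact: Homog1.
by rewrite big_cons; apply: (@HomogM _ _ false false) => //; exact: stT_even.
Qed.

(** The letters of [u] are processed from the smallest on.  Each [T_i] either
    contributes the letter [i] to [w], or a scalar factor, and in both cases it
    absorbs or creates a Clifford generator that the next letter must match.
    Dropping a letter leads to a shorter word, on which [phi] vanishes unless
    the word is empty; this is the origin of the second term. *)
Lemma expansion u w : incr (w ++ u) ->
  (forall w', incr w' -> w' != [::] -> (size w' < size w + size u)%N -> phi w' = 0) ->
  t (RW w * TW u) = leading None u * phi (w ++ u) +
     ((w == [::]) && (u != [::]))%:R * (delta ^+ size u * phi [::])
  /\ forall k, w != [::] -> all (fun i => k <= i)%N u ->
     t (RW w * (c k * TW u)) = leading (Some (val k)) u * phi (w ++ u).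
Proof.
elim: u w => [|i u IH] w iwu short.
  split=> [|k _ _]; rewrite /TW big_nil cats0 /=.
    by rewrite andbF mulr1 mul1r mul0r addr0.
  rewrite mul0r; apply: once; [by rewrite mulr1 mul1r|exact: Homog1|exact: RW_once].
have iu : incr (i :: u) by move: iwu; rewrite incr_cat => /and3P[].
have iwu2 : incr (w ++ u).
  move: iwu; rewrite !incr_cat incr_cons => /and3P[-> /andP[-> _] wiu] /=.
  by apply: sub_all wiu => j /= /andP[].
move: iu; rewrite incr_cons => /andP[iu iltu].
have [||A1 B1] := IH (rcons w i); rewrite ?cat_rcons ?size_rcons ?addSnnS //.
have [//|w' iw' w'0 sw'|A2 B2] := IH w.
  by apply: short => //; rewrite /= addnS ltnS ltnW.
have TWE : TW (i :: u) = T i * TW u by rewrite /TW big_cons.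
have cX : c (ix0 i) * TW u = TW u * c (ix0 i) by exact: TW_comm.
have rw0 : rcons w i != [::] by case: (w).
have wu0 : w ++ u != [::] -> phi (w ++ u) = 0.
  by move=> ne; apply: short => //; rewrite size_cat /= addnS.
have Bx : t (RW (rcons w i) * (c (ix1 i) * TW u)) =
          leading (Some i.+1) u * phi (w ++ i :: u).
  by rewrite B1 // cat_rcons.
split.
  rewrite TWE expand_T //; last exact: TW_homog.
  rewrite Bx A2 /= andbT; congr (_ + _); first by rewrite mulrA.
  have [u0|u0] := eqVneq u [::].
    have [w0|w0] := eqVneq w [::].
      by rewrite u0 w0 /= mul0r addr0 !mul1r expr1.
    by rewrite wu0 ?mulr0 ?add0r ?mul0r ?mulr0 //; case: (w) w0.
  rewrite wu0 ?mulr0 ?add0r; last by case: (w) (u) u0 => [|? ?] [].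
  by rewrite andbT mulrCA exprS !mulrA.
move=> k w0 /andP[ki _]; rewrite /=.
have [ki'|ki'] := eqVneq (val k) (val i).
  have -> : k = ix0 i by apply: val_inj.
  rewrite TWE expand_cT //; last exact: TW_homog.
  rewrite A1 (negPf rw0) mul0r addr0 cat_rcons B2 // wu0 ?mulr0 ?subr0.
    by rewrite mul1r mulrA.
  by case: (w) w0.
rewrite !mul0r; apply: once; [|exact: TW_homog|exact: RW_once].
apply: TW_comm; rewrite /= ltn_neqAle ki' ki /=.
by apply: sub_all iltu => j ij; exact: leq_ltn_trans ij.
Qed.

End Expansion.

(** * The canonical trace form *)

Section Vanishing.
Variables (K : fieldType) (v : K) (m : nat).
Hypotheses (v0 : v != 0) (two0 : 2%:R != 0 :> K).
Local Notation S := (palg (stensor (spin_hecke v m) (clifford K m))).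
Variable Psi : {rmorphism S -> palg (hecke_clifford v m)}.
Hypothesis PsiP : Psi_spec Psi.
Implicit Types (u w : seq 'I_m) (i j : 'I_m).

Lemma trace_function_emb_l (t : S -> K) : trace_function t ->
  trace_function (fun h => t (emb_l h)).
Proof.
move=> tr_t; split=> [a x y|x y|x x1].
- by rewrite emb_lD emb_lZ (traceD tr_t) (traceZ tr_t).
- by rewrite !emb_lM (trace_comm tr_t).
- by apply: (trace_odd tr_t); apply: HomogGen.
Qed.

Variables (t : S -> K) (tr_t : trace_function t).
Local Notation phi u := (t (emb_l (shR_word v u))).

Let Tn (i : nat) : S := if insub i is Some j then stT v j else 1.

Let TnE (i : nat) (im : (i < m)%N) : Tn i = stT v (Ordinal im).
Proof. by rewrite /Tn insubT. Qed.

Lemma trace_stT_perm g1 g2 : all odd g1 -> sumn g1 = m.+1 -> perm_eq g2 g1 ->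
  t (\prod_(i <- gamma_word m g2) stT v i) = t (\prod_(i <- gamma_word m g1) stT v i).
Proof.
move=> og gm pg.
have wordE g : sumn g = m.+1 ->
    \prod_(i <- gamma_word m g) stT v i = Tword Tn (gamma_word_from 0 g).
  move=> sg; rewrite -(@gamma_wordE m) // /Tword big_map.
  by apply: eq_bigr => i _; rewrite /Tn valK.
rewrite !wordE ?(perm_sumn pg) //.
apply: (@trace_gamma_perm _ Tn m _ _ _ _ t _ g1 g2) => //.
- move=> i j /andP[ij jm]; have im : (i < m)%N by lia.
  rewrite (TnE im) (TnE jm).
  by apply: (stT_far v0 two0 PsiP); rewrite /far ij.
- move=> i im; have im' : (i < m)%N by lia.
  rewrite (TnE im) (TnE im').
  exact: (stT_braid v0 two0 PsiP).
- move=> i im; rewrite (TnE im).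
  exact: (stT_inv v0 two0 PsiP).
- exact: trace_comm.
- by apply: sub_all og => -[].
Qed.

Lemma trace_stT_word u : incr u -> u != [::] ->
  (forall w, incr w -> w != [::] -> (size w < size u)%N -> phi w = 0) ->
  t (\prod_(i <- u) stT v i) =
  leading K None u * phi u + ((v - 1) / 2) ^+ size u * t 1.
Proof.
move=> iu u0 short; have [//|E _] := expansion v0 two0 PsiP tr_t (w := [::]) iu.
by move: E; rewrite shR_nil emb_l1 !mul1r /= u0 mul1r => ->.
Qed.

(** Induction on the length: an increasing word with a block of oddly many
    letters gives zero anyway, and any other is compared with the word of the
    sorted composition, through the common value of the trace on the two
    products of Hecke generators. *)
Lemma trace_vanishing :
  (forall nu, odd_partition m.+1 nu -> gamma_word m nu != [::] ->
     (forall w, incr w -> w != [::] -> (size w < size (gamma_word m nu))%N ->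
        phi w = 0) ->
     phi (gamma_word m nu) = 0) ->
  forall u, incr u -> u != [::] -> phi u = 0.
Proof.
move=> part0 u; have [n] := ubnP (size u); elim: n u => // n IH u un iu u0.
have short w : incr w -> w != [::] -> (size w < size u)%N -> phi w = 0.
  by move=> iw w0 wu; apply: IH => //; apply: leq_trans wu _.
have [pu|npu] := boolP (paired u); last first.
  exact: (trace_unpaired two0 (trace_function_emb_l tr_t)).
have [g [og gm Eg]] := paired_gamma_word iu pu.
have Eu : u = gamma_word m g by apply: (inj_map val_inj); rewrite gamma_wordE.
pose nu := sort geq g.
have pnu : perm_eq nu g by rewrite /nu perm_sort.
have onu : all odd nu by rewrite (perm_all _ pnu).
have num : sumn nu = m.+1 by rewrite (perm_sumn pnu).
have sz : size (gamma_word m nu) = size u.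
  by rewrite Eu !size_gamma_word // (perm_size pnu).
have nu0 : gamma_word m nu != [::] by rewrite -size_eq0 sz size_eq0.
have phinu : phi (gamma_word m nu) = 0.
  apply: part0 => // [|w iw w0]; last by rewrite sz; exact: short.
  rewrite /odd_partition onu num eqxx !andbT; apply: sort_sorted => x y.
  exact: leq_total.
have := trace_stT_perm og gm pnu; rewrite -Eu !trace_stT_word ?incr_gamma_word //.
  rewrite sz phinu mulr0 add0r => /eqP; rewrite eq_sym -subr_eq0 addrK.
  by rewrite mulf_eq0 (negPf (leading_neq0 two0 pu)) => /eqP.
by move=> w iw w0; rewrite sz; exact: short.
Qed.

End Vanishing.

Lemma odd_partition_ones m : odd_partition m.+1 (nseq m.+1 1%N).
Proof.
rewrite /odd_partition sumn_nseq mul1n eqxx all_nseq orbT !andbT.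
by rewrite /=; elim: m => //= m ->.
Qed.

Lemma gamma_word_nil m nu : odd_partition m.+1 nu ->
  (gamma_word m nu == [::]) = (nu == nseq m.+1 1%N).
Proof.
case/and3P=> _ onu /eqP num; rewrite -size_eq0 size_gamma_word // -num.
have sz : (sumn nu - size nu == 0)%N -> nu = nseq (sumn nu) 1%N.
  elim: nu onu {num} => [|g nu IH] //= /andP[og onu].
  have le : (size nu <= sumn nu)%N.
    by elim: (nu) onu => [|g' s IHs] //= /andP[og' /IHs]; case: g' og' => // g' _; lia.
  case: g og => // g _; case: g => [|g]; last by lia.
  by rewrite add1n subSS => /(IH onu) E; rewrite /= -E.
apply/idP/eqP => [/sz //|->].
by rewrite sumn_nseq mul1n size_nseq subnn.
Qed.

Lemma Cvhalf_ext_char0 (R : realType) (K : fieldExtType (Cvhalf R)) n :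
  n.+1%:R != 0 :> K.
Proof.
rewrite -(rmorph_nat (in_alg K)) fmorph_eq0 /Cvhalf -(rmorph_nat (@tofrac _)).
by rewrite tofrac_eq0 -polyC_natr polyC_eq0 Num.Theory.pnatr_eq0.
Qed.

Theorem theorem6p10 (R : realType) (m : nat)
    (K : fieldExtType (Cvhalf R)) (hK : is_sqrt_extension m.+1 K)
    (v : K) (hv : v = (vv R)%:A)
    (Psi : {rmorphism palg (stensor (spin_hecke v m) (clifford K m))
                      -> palg (hecke_clifford v m)})
    (hPsi : Psi_spec Psi)
    (gimel : palg (hecke_clifford v m) -> K) (hgimel : is_gimel gimel) :
  (forall C : {set 'S_m.+1},
     C \in classes [set: 'S_m.+1] -> C != [set 1%g] ->
     forall w : 'S_m.+1, minimal_length_in C w ->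
     forall u : seq 'I_m, reduced_expression w u ->
     gimel_minus Psi gimel (shR_word v u) = 0)
  /\
  [/\ trace_function (gimel_minus Psi gimel),
      delta_on_OP (gimel_minus Psi gimel)
    & forall phi : palg (spin_hecke v m) -> K,
        trace_function phi -> delta_on_OP phi ->
        phi =1 gimel_minus Psi gimel].
Proof.
have K0 := Cvhalf_ext_char0 K.
have two0 : 2%:R != 0 :> K := K0 1%N.
have v0 : v != 0.
  rewrite hv -[_%:A]/(in_alg K _) fmorph_eq0 /vv tofrac_eq0 expf_eq0 andTb.
  by rewrite polyX_eq0.
have [tr_g gimelP] := hgimel.
have [PsiZ _ Psi_homog _ _] := hPsi.
have tr_t : trace_function (fun x => gimel (Psi x)).
  split=> [a x y|x y|x x1].
  - by rewrite rmorphD PsiZ (traceD tr_g) (traceZ tr_g).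
  - by rewrite !rmorphM (trace_comm tr_g).
  - by apply: (trace_odd tr_g); exact: Psi_homog.
have gmE h : gimel_minus Psi gimel h = gimel (Psi (emb_l h)).
  by rewrite /gimel_minus pure_tensor_l.
have tr_gm : trace_function (gimel_minus Psi gimel).
  rewrite (_ : gimel_minus _ _ = fun h => gimel (Psi (emb_l h))).
    exact: (trace_function_emb_l tr_t).
  exact/funext.
have ones0 : gamma_word m (nseq m.+1 1%N) = [::].
  by apply/eqP; rewrite gamma_word_nil ?odd_partition_ones.
have gimel1 : gimel 1 = 1.
  have := gimelP _ (odd_partition_ones m).
  by rewrite ones0 size_nseq subnn /hcT_word big_nil.
(* The prescribed values of [gimel] are the second term of [trace_stT_word], so
   the first one vanishes. *)
have incr0 u : incr u -> u != [::] -> gimel_minus Psi gimel (shR_word v u) = 0.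
  rewrite gmE; apply: (trace_vanishing v0 two0 hPsi tr_t) => nu nuP nu0 short.
  have /and3P[_ onu /eqP num] := nuP.
  have := trace_stT_word v0 two0 hPsi tr_t (incr_gamma_word num) nu0 short.
  rewrite (Psi_stT_word v0 two0 hPsi) gimelP // rmorph1 gimel1 mulr1.
  rewrite size_gamma_word // => /eqP; rewrite eq_sym -subr_eq0 addrK.
  rewrite mulf_eq0 => /orP[l0|/eqP //].
  (* Only an unpaired word can have a zero leading coefficient. *)
  apply: (trace_unpaired two0 (trace_function_emb_l tr_t)) (incr_gamma_word num) _.
  by apply: contraL l0; exact: leading_neq0.
have gm_delta : delta_on_OP (gimel_minus Psi gimel).
  move=> nu nuP; rewrite -(gamma_word_nil nuP).
  have [->|nu0] := eqVneq (gamma_word m nu) [::].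
    by rewrite shR_nil gmE emb_l1 rmorph1.
  by have /and3P[_ _ /eqP num] := nuP; apply: incr0 => //; exact: incr_gamma_word.
split; last split=> // phi tr_phi phi_delta h.
  move=> C CP C1 w wmin u uw; have [Ew _] := uw.
  apply: (trace_uniq tr_gm incr0).
    by apply: (@minimal_length_uniq m C u) => //; rewrite Ew.
  apply: contra C1 => /eqP u0; move: wmin; rewrite -Ew u0 sprod_nil => -[C1 _].
  by case/imsetP: CP C1 => g _ -> /class_eqP <-; rewrite class1G.
apply/eqP; rewrite -subr_eq0; apply/eqP.
pose chi h := phi h - gimel_minus Psi gimel h.
have tr_chi : trace_function chi.
  split=> [a x y|x y|x x1]; rewrite /chi.
  - rewrite !(traceD tr_phi, traceD tr_gm, traceZ tr_phi, traceZ tr_gm) mulrBr.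
    by rewrite opprD addrACA.
  - by rewrite (trace_comm tr_phi) (trace_comm tr_gm).
  - by rewrite (trace_odd tr_phi x1) (trace_odd tr_gm x1) subrr.
have chi_delta nu : odd_partition m.+1 nu -> chi (shR_word v (gamma_word m nu)) = 0.
  by move=> nuP; rewrite /chi phi_delta // gm_delta // subrr.
have [t [tr_t' tE]] := extend_trace K0 tr_chi.
rewrite -/(chi h); apply: (trace_eq0 tr_chi) => u iu.
have [->|u0] := eqVneq u [::].
  by rewrite -ones0 chi_delta ?odd_partition_ones.
rewrite -tE pure_tensor_l; apply: (trace_vanishing v0 two0 hPsi tr_t') => // nu nuP _ _.
by rewrite -pure_tensor_l tE chi_delta.
Qed.
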